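(* Let $F$ be a continuous distribution function symmetric about zero, and $G$ a continuous distribution function with zero median; let $\varepsilon_n\in(0,1]$ with $\varepsilon_n\to0$ and $\mu_n>0$. Assume that $F$ and $G$ have densities $f$ and $g$, and that $$G(x)+G(-x)\le1,\qquad\forall x\in\mathbb{R}.$$ Define $\zeta_n=\frac12-\int G(x-\mu_n)f(x)\,dx$ and $\lambda_n=\frac12-\int G(-x-2\mu_n)g(x)\,dx$. Then the signed-rank test, based on the statistic $W$, is asymptotically powerful if $$\sqrt{n}\,\varepsilon_n\,\max(\zeta_n,\varepsilon_n\lambda_n)\to\infty,$$ and asymptotically powerless if $$\sqrt{n}\,\varepsilon_n\,\max(\zeta_n,\varepsilon_n\lambda_n)\to0.$$
   Context: Testing problem: for each $n$ one observes $X_1,\dots,X_n\in\mathbb{R}$ and tests $H_0^n$: $X_1,\dots,X_n$ are i.i.d. with distribution function $F(x)$, versus $H_1^n$: $X_1,\dots,X_n$ are i.i.d. with distribution function $(1-\varepsilon_n)F(x)+\varepsilon_n G(x-\mu_n)$. Limits are as $n\to\infty$. $F$ symmetric about zero means $F(-x)=1-F(x)$ for all $x$. Wilcoxon signed-rank test: order the observations so that $|X_{(1)}|>\cdots>|X_{(n)}|$ (almost surely there are no ties), put $\xi_{(i)}=\mathrm{sign}(X_{(i)})\in\{-1,1\}$; the test rejects for large values of $W=\sum_{i=1}^n(n-i+1)\,\xi_{(i)}$. A test based on a statistic $S$ is asymptotically powerful (resp. powerless) if the total variation distance between the distribution of $S$ under $H_0^n$ and its distribution under $H_1^n$ tends to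 $2$ (resp. $0$), with the normalization $\|P-Q\|=2\sup_A|P(A)-Q(A)|$, for which the maximal value is $2$. *)

(* Defs.v *)
From HB Require Import structures.
From mathcomp Require Import all_boot all_order all_algebra.
From mathcomp Require Import all_classical all_reals all_analysis.
From mathcomp Require Import measurable_realfun.

Set Implicit Arguments.
Unset Strict Implicit.
Unset Printing Implicit Defensive.

Import Order.TTheory GRing.Theory Num.Theory.
Import numFieldNormedType.Exports.

Local Open Scope classical_set_scope.
Local Open Scope ring_scope.

(* A distribution function is a [cumulativeBounded 0 1]: nondecreasing,
   right-continuous, with limits 0 at -oo and 1 at +oo. *)
Definition is_density (R : realType) (F f : R -> R) : Prop :=
  [/\ measurable_fun setT f,
      (forall x, 0 <= f x) &
      forall x, (F x)%:E = (\int[lebesgue_measure]_(t in `]-oo, x]) (f t)%:E)%E].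

Definition contaminated (R : realType) (F G : R -> R) (eps mu x : R) : R :=
  (1 - eps) * F x + eps * G (x - mu).

Definition mutually_independent (R : realType) (d : measure_display)
    (T : measurableType d) (P : probability T R) (n : nat)
    (X : 'I_n -> {mfun T >-> R}) : Prop :=
  forall (J : {set 'I_n}) (B : 'I_n -> set R),
    (forall i, measurable (B i)) ->
    P (\bigcap_(i in [set` J]) (X i @^-1` B i)) =
    (\prod_(i in J) P (X i @^-1` B i))%E.

Definition iid (R : realType) (d : measure_display)
    (T : measurableType d) (P : probability T R) (n : nat)
    (X : 'I_n -> {mfun T >-> R}) (H : R -> R) : Prop :=
  mutually_independent P X /\
  forall (i : 'I_n) (x : R), cdf (X i : {RV P >-> R}) x = (H x)%:E.

(* Indices listed by decreasing absolute value of the observations; ties, an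
   event of probability zero for continuous laws, keep the index order. *)
Definition abs_order (R : realType) (n : nat) (x : 'I_n -> R) : n.-tuple 'I_n :=
  [tuple of sort (fun i j => `|x j| <= `|x i|) (ord_tuple n)].

(* Position [k] counts from 0, so [n - k] is the weight n - i + 1 of the
   1-based position i = k + 1.  An observation equal to 0, also an event of
   probability zero, is given sign 0. *)
Definition signed_rank (R : realType) (n : nat) (x : 'I_n -> R) : R :=
  \sum_(k < n) (n - k)%:R * Num.sg (x (tnth (abs_order x) k)).

Definition signed_rank_stat (R : realType) (d : measure_display)
    (T : measurableType d) (n : nat) (X : 'I_n -> {mfun T >-> R}) : T -> R :=
  fun w => signed_rank (fun i => X i w).

Section signed_rank_measurable.
Context (R : realType) (d : measure_display) (T : measurableType d) (n : nat).
Variable X : 'I_n -> {mfun T >-> R}.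

Let pattern (w : T) : {ffun 'I_n * 'I_n -> bool} :=
  [ffun p => `|X p.2 w| <= `|X p.1 w|].

Let order_of (c : {ffun 'I_n * 'I_n -> bool}) : n.-tuple 'I_n :=
  [tuple of sort (fun i j => c (i, j)) (ord_tuple n)].

Let order_ofE w : abs_order (fun i => X i w) = order_of (pattern w).
Proof.
apply: val_inj => /=; congr (sort _ _).
by apply/funext => i; apply/funext => j; rewrite ffunE.
Qed.

Let measurable_pattern c : measurable [set w | pattern w = c].
Proof.
rewrite [X in measurable X](_ : _ =
    \bigcap_(p in [set: 'I_n * 'I_n])
      [set w | (`|X p.2 w| <= `|X p.1 w|) = c p]); last first.
  apply/seteqP; split=> w /=.
    by move=> <- p _ /=; rewrite ffunE.
  by move=> wc; apply/ffunP => p; rewrite ffunE; exact: wc.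
apply: fin_bigcap_measurable; first exact: finite_finset.
move=> p _; rewrite -[X in measurable X]setTI.
apply: (@measurable_fun_ler _ _ _ setT (fun w => `|X p.2 w|)
  (fun w => `|X p.1 w|) _ _ measurableT [set c p]) => //.
- exact: measurableT_comp.
- exact: measurableT_comp.
Qed.

Lemma measurable_signed_rank_stat : measurable_fun setT (signed_rank_stat X).
Proof.
rewrite (_ : signed_rank_stat X = fun w =>
    \sum_(c : {ffun 'I_n * 'I_n -> bool}) \1_[set w | pattern w = c] w *
      \sum_(k < n) (n - k)%:R * Num.sg (X (tnth (order_of c) k) w)); last first.
  apply/funext => w; rewrite (bigD1 (pattern w))//= indicE mem_set// mul1r.
  rewrite [X in _ + X]big1 ?addr0.
    by rewrite /signed_rank_stat /signed_rank order_ofE.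
  move=> c cw; rewrite indicE memNset ?mul0r// => /= wc.
  by rewrite wc eqxx in cw.
apply: measurable_sum => c; apply: measurable_funM.
  exact: measurable_indic.
apply: measurable_sum => k; apply: measurable_funM => //.
rewrite (_ : (fun _ => _) = (fun w =>
    \1_`]0, +oo[%classic (X (tnth (order_of c) k) w) -
    \1_`]-oo, 0[%classic (X (tnth (order_of c) k) w) : R)); last first.
  apply/funext => w; rewrite !indicE; set r := X _ w.
  have [r0|r0|r0] := ltrgt0P r.
  - by rewrite (gtr0_sg r0) mem_set ?memNset ?subr0//= in_itv/= ?r0//
      ltNge ltW.
  - by rewrite (ltr0_sg r0) memNset ?mem_set ?sub0r//= in_itv/= ?r0
      ?andbT// ltNge ltW.
  - by rewrite r0 sgr0 !memNset ?subrr//= in_itv/= ?ltxx.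
by apply: measurable_funB; apply: measurableT_comp => //; exact: measurable_indic.
Qed.

HB.instance Definition _ := isMeasurableFun.Build _ _ _ _
  (signed_rank_stat X) measurable_signed_rank_stat.

End signed_rank_measurable.

Definition tv_dist (R : realType) (d : measure_display) (T : measurableType d)
    (P Q : probability T R) : R :=
  2 * sup [set `|fine (P A) - fine (Q A)| | A in measurable].

Section asymptotic_testing.
Context (R : realType) (d : nat -> measure_display)
  (T : forall n, measurableType (d n)).
Variables (P0 P1 : forall n, probability (T n) R)
  (S : forall n, {mfun T n >-> R}).

Definition asymptotically_powerful : Prop :=
  tv_dist (distribution (P0 n) (S n)) (distribution (P1 n) (S n))
    @[n --> \oo] --> (2 : R).

Definition asymptotically_powerless : Prop :=
  tv_dist (distribution (P0 n) (S n)) (distribution (P1 n) (S n))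
    @[n --> \oo] --> (0 : R).

End asymptotic_testing.

Definition zeta (R : realType) (G f : R -> R) (mu : R) : R :=
  2^-1 - \int[lebesgue_measure]_x (G (x - mu) * f x).

Definition lambda (R : realType) (G g : R -> R) (mu : R) : R :=
  2^-1 - \int[lebesgue_measure]_x (G (- x - 2 * mu) * g x).

(* Main.v *)
(* Under [H1] an observation is drawn from [F] with probability [1 - eps] and
   is otherwise contaminated.  The statistic is the sum of [c i * sg (X i)],
   where [c i] counts the [j] with [`|X j| <= `|X i|].  Replacing [c i] by
   [n K(`|X i|)], with [K] the distribution function of the absolute values,
   costs [O(n^(3/2))] in mean, so the statistic stays within [O(n^(3/2))] of
   [n^2 m] with [m = 2 eps (1 - eps) zeta + eps^2 lambda], and Markov's
   inequality settles the powerful regime.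

   For the powerless regime, the signs of the uncontaminated observations are
   fair and independent of everything else, and the signed ranks of the
   contaminated ones add up to [D] with [E `|D|] at most [n^2 m + o(n^(3/2))].
   Conditionally on the rest, the statistic is thus a fair signed sum over all
   but [O(eps n)] of the ranks, translated by [D].  Such a sum is smooth at
   scale [n^(3/2)]: swapping the signs of the ranks [i] and [i + d], for a
   random [i] where these signs are [-, +], translates it by [-2 d] and almost
   preserves its law, so a translation by [2 d] costs [O(n^(-1/2))] in total
   variation for every [d <= n / 4]. *)
Require Import Defs.
From HB Require Import structures.
From mathcomp Require Import all_boot all_order all_algebra.
From mathcomp Require Import all_classical all_reals all_analysis.
From mathcomp Require Import measurable_realfun ring lra zify.

Set Implicit Arguments.
Unset Strict Implicit.
Unset Printing Implicit Defensive.

Import Order.TTheory GRing.Theory Num.Theory.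
Import numFieldNormedType.Exports.

Local Open Scope ring_scope.

(** * Averages over independent fair signs *)

(** Total variation between integer-valued laws is not controlled by a central limit theorem; hence
    the smoothness bound, which compares integer translates directly. Even translations are enough,
    because two signed sums over the same ranks have the same parity. Both hypotheses are compared
    with one reference law, the fully fair signed sum, and the null is treated as contamination
    level 0, so each estimate is proved once. The given observations carry no contamination flags.
    As the law of the statistic depends only on the law of the sample, it is computed on a latent
    sample of flagged observations. The inequality |x| <= (c + x^2 / c) / 2 takes the place of
    Cauchy-Schwarz. Its free parameter [eta] survives to the end, where [eta] and [eps / eta] must
    both be small, which [eps -> 0] permits. For the contaminated observations the rank error has to
    be o(n^(3/2)); it is therefore kept proportional to the mean absolute weight, which is at most
    [eps]. *)

Section sign_average.
Context (R : rcfType) (I : finType).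
Implicit Types (phi : {ffun I -> bool} -> R) (s t : {ffun I -> bool}).

Definition sign_avg phi : R := (\sum_s phi s) / 2 ^+ #|I|.

Definition sign_of s i : R := (-1) ^+ s i.

Definition flip (A : {set I}) s : {ffun I -> bool} :=
  [ffun i => s i (+) (i \in A)].

Lemma flipK A : involutive (flip A).
Proof. by move=> s; apply/ffunP => i; rewrite !ffunE -addbA addbb addbF. Qed.

Lemma sign_of_flip A s i : sign_of (flip A s) i = (-1) ^+
  (i \in A) * sign_of s i.
Proof. by rewrite /sign_of ffunE signr_addb mulrC. Qed.

Lemma sign_of_sq s i : sign_of s i * sign_of s i = 1.
Proof. by rewrite -signr_addb addbb. Qed.

Lemma eq_sign_avg phi1 phi2 : phi1 =1 phi2 -> sign_avg phi1 = sign_avg phi2.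
Proof. by move=> e; rewrite /sign_avg (eq_bigr _ (fun s _ => e s)). Qed.

Lemma sign_avg_flip A phi : sign_avg (fun s => phi (flip A s)) = sign_avg phi.
Proof.
by rewrite /sign_avg [in RHS](reindex_inj (can_inj (flipK A))).
Qed.

Lemma sign_avg_cst (c : R) : sign_avg (fun=> c) = c.
Proof.
rewrite /sign_avg sumr_const card_ffun card_bool -[c *+ _]mulr_natr natrX.
by rewrite mulfK// expf_neq0// pnatr_eq0.
Qed.

Lemma sign_avgD phi1 phi2 : sign_avg (fun s => phi1 s + phi2 s) =
  sign_avg phi1 + sign_avg phi2.
Proof. by rewrite /sign_avg big_split mulrDl. Qed.

Lemma sign_avgN phi : sign_avg (fun s => - phi s) = - sign_avg phi.
Proof. by rewrite /sign_avg sumrN mulNr. Qed.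

Lemma sign_avgB phi1 phi2 : sign_avg (fun s => phi1 s - phi2 s) =
  sign_avg phi1 - sign_avg phi2.
Proof. by rewrite sign_avgD sign_avgN. Qed.

Lemma sign_avgZ c phi : sign_avg (fun s => c * phi s) = c * sign_avg phi.
Proof. by rewrite /sign_avg -mulr_sumr mulrA. Qed.

Lemma sign_avg_sum (J : finType) (P : pred J) (phi : J -> {ffun I -> bool} ->
  R) :
  sign_avg (fun s => \sum_(j | P j) phi j s) = \sum_(j | P j) sign_avg (phi j).
Proof. by rewrite /sign_avg exchange_big mulr_suml. Qed.

Lemma ler_sign_avg phi1 phi2 : (forall s, phi1 s <= phi2 s) ->
  sign_avg phi1 <= sign_avg phi2.
Proof. by move=> e; rewrite /sign_avg ler_wpM2r ?invr_ge0 ?exprn_ge0//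
  ler_sum. Qed.

Lemma ler_norm_sign_avg phi : `|sign_avg phi| <= sign_avg (fun s => `|phi s|).
Proof.
rewrite /sign_avg normrM [X in _ * X <= _]ger0_norm ?invr_ge0 ?exprn_ge0//.
by rewrite ler_wpM2r ?invr_ge0 ?exprn_ge0// ler_norm_sum.
Qed.

Lemma sign_avg_odd A phi : (forall s, phi (flip A s) = - phi s) ->
  sign_avg phi = 0.
Proof.
move=> e; have := sign_avg_flip A phi.
by rewrite (eq_sign_avg e) sign_avgN => ?; lra.
Qed.

(** Expands the nonnegative [(|x| - c)^2 / c]. Being linear in [x ^+ 2], the bound passes through
    averages and turns second moments into first moments. *)
Lemma ler_norm_amgm (c x : R) : 0 < c -> `|x| <= (c + x ^+ 2 / c) / 2.
Proof.
move=> c0; have : 0 <= (`|x| - c) ^+ 2 / c by rewrite divr_ge0 ?sqr_ge0 ?ltW.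
rewrite (_ : _ / c = c + x ^+ 2 / c - 2 * `|x|); first by move=> ?; lra.
by rewrite -[x ^+ 2]real_normK ?num_real//; field; rewrite gt_eqF.
Qed.

(** Orthonormality makes the second moment of the sum equal to [#|J|]; [ler_norm_amgm] with
    [c = sqrt #|J|] then averages to [c] itself. *)
Lemma sign_avg_norm_sum_orth (J : {set I}) (chi : I -> {ffun I -> bool} -> R) :
  (forall i s, chi i s * chi i s = 1) ->
  (forall i j, i \in J -> j \in J -> i != j -> sign_avg (fun s =>
    chi i s * chi j s) = 0) ->
  sign_avg (fun s => `|\sum_(i in J) chi i s|) <= Num.sqrt #|J|%:R.
Proof.
move=> chi1 chi0; have [->|J0] := eqVneq J finset.set0.
  rewrite cards0 sqrtr0 (@eq_sign_avg _ (fun=> 0)) ?sign_avg_cst// => s.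
  by rewrite big_set0 normr0.
set c := Num.sqrt _; have c0 : 0 < c by rewrite sqrtr_gt0 ltr0n card_gt0.
have -> : c = sign_avg (fun s => (c + (\sum_(i in J) chi i s) ^+ 2 / c) / 2).
  under eq_sign_avg do rewrite mulrC.
  rewrite sign_avgZ sign_avgD sign_avg_cst.
  under eq_sign_avg do rewrite mulrC.
  rewrite sign_avgZ.
  have -> : sign_avg (fun s => (\sum_(i in J) chi i s) ^+ 2) = c ^+ 2.
    under eq_sign_avg => s do rewrite expr2 mulr_suml.
    rewrite sign_avg_sum sqr_sqrtr// -sumr_const.
    apply: eq_bigr => i iJ.
    under eq_sign_avg => s do rewrite mulr_sumr.
    rewrite sign_avg_sum (bigD1 i)//= (eq_sign_avg
      (chi1 i)) sign_avg_cst big1 ?addr0//.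
    by move=> j /andP[jJ ji]; rewrite chi0// eq_sym.
  by field; rewrite gt_eqF.
by apply: ler_sign_avg => s; apply: ler_norm_amgm.
Qed.

End sign_average.

(** * Smoothness of a signed sum under exchanges of two signs *)

Section stein.
Context (R : rcfType) (I : finType) (c : I -> R) (U J : {set I}) (q : I -> I).
Variables (delta : R) (h : R -> R).
Hypothesis h01 : forall x, 0 <= h x <= 1.
Hypothesis JU : forall i, i \in J -> i \in U.
Hypothesis qU : forall i, i \in J -> q i \in U.
Hypothesis q_inj : {in J &, injective q}.
Hypothesis cq : forall i, i \in J -> c (q i) = c i + delta.
Hypothesis delta_gt0 : 0 < delta.

Let S (s : {ffun I -> bool}) : R := \sum_(i in U) c i * sign_of R s i.
Let e0 i s : R := (1 - sign_of R s i) * (1 + sign_of R s (q i)) / 4.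
Let e1 i s : R := (1 + sign_of R s i) * (1 - sign_of R s (q i)) / 4.

Let qNid i : i \in J -> (q i == i) = false.
Proof.
move=> iJ; apply/negP => /eqP qi; have := cq iJ; rewrite qi => {qi} cE.
by move: delta_gt0 cE => ? ?; lra.
Qed.

(* Exchanging the signs of [i] and [q i] maps the pattern (-, +), counted
   by [e0], to the pattern (+, -), counted by [e1], and moves [S] by
   [- 2 delta]. *)
Let swap i : i \in J ->
  sign_avg (fun s => e1 i s * h (S s + 2 * delta)) = sign_avg (fun s =>
    e0 i s * h (S s)).
Proof.
move=> iJ; rewrite -(sign_avg_flip [set i; q i]); apply: eq_sign_avg => s.
have qi := qNid iJ; have iq : (i == q i) = false by rewrite eq_sym.
rewrite /e1 /e0 !sign_of_flip !inE !eqxx ?orbT ?expr1 !mulN1r opprK.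
have [->|] := eqVneq (sign_of R s i) 1; first by rewrite subrr !mul0r.
have [->|] := eqVneq (sign_of R s (q i)) (-1); first by rewrite !subrr mulr0
  !mul0r.
move=> qsN1 sN1; congr (_ * h _).
have s1 : sign_of R s i = -1.
  by move: sN1; rewrite /sign_of; case: (s i); rewrite ?expr0 ?eqxx.
have qs1 : sign_of R s (q i) = 1.
  by move: qsN1; rewrite /sign_of; case: (s (q i)); rewrite ?expr1 ?eqxx.
rewrite /S (bigD1 i) ?JU//= (bigD1 (q i)) ?qU ?qi//=.
rewrite [RHS](bigD1 i) ?JU//= [in RHS](bigD1 (q i)) ?qU ?qi//=.
rewrite !sign_of_flip !inE !eqxx ?orbT expr1 s1 qs1 cq//.
rewrite (eq_bigr (fun j => c j * sign_of R s j)); last first.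
  move=> j /andP[/andP[_ ji] jq]; rewrite sign_of_flip !inE.
  by rewrite (negbTE ji) (negbTE jq) expr0 mul1r.
by lra.
Qed.

(** The product expands into a constant and three sign characters, all with coefficient [1 / 4] up
    to sign. Over [J], each of the three families is orthonormal and contributes at most
    [sqrt #|J| / 4]. *)
Let pattern_deviation (eps : R) (eps2 : R) : `|eps| = 1 -> `|eps2| = 1 ->
  sign_avg (fun s => `|\sum_(i in J) ((1 + eps * sign_of R s i) *
    (1 + eps2 * sign_of R s (q i)) / 4)
     - #|J|%:R / 4|) <= 3 / 4 * Num.sqrt #|J|%:R.
Proof.
move=> E1 E2.
have o1 : sign_avg (fun s => `|\sum_(i in J) sign_of R s i|) <=
  Num.sqrt #|J|%:R.
  apply: sign_avg_norm_sum_orth => [i s|i j iJ jJ ij]; first exact: sign_of_sq.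
  apply: (@sign_avg_odd _ _ [set i]) => s.
  rewrite !sign_of_flip !inE eqxx expr1 (eq_sym j) (negbTE ij) expr0; lra.
have o2 : sign_avg (fun s => `|\sum_(i in J) sign_of R s
  (q i)|) <= Num.sqrt #|J|%:R.
  apply: (@sign_avg_norm_sum_orth _ _ _ (fun i s => sign_of R s (q i))) =>
    [i s|i j iJ jJ ij].
    exact: sign_of_sq.
  apply: (@sign_avg_odd _ _ [set q i]) => s.
  rewrite !sign_of_flip !inE eqxx expr1.
  by rewrite (inj_in_eq q_inj)// (eq_sym j) (negbTE ij) expr0; lra.
have o3 : sign_avg (fun s => `|\sum_(i in J) sign_of R s i * sign_of R s
  (q i)|) <= Num.sqrt #|J|%:R.
  apply: (@sign_avg_norm_sum_orth _ _ _ (fun i s =>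
    sign_of R s i * sign_of R s (q i))) => [i s|].
    by rewrite mulrACA !sign_of_sq mulr1.
  (* The pairs [{i, q i}] and [{j, q j}] overlap when [q] chains sites. A site [i] of smallest
     coefficient still occurs only once in the product, since [q] increases [c], so flipping its
     sign negates the product. *)
  have key i j : i \in J -> j \in J -> i != j -> c i <= c j ->
      sign_avg (fun s => sign_of R s i * sign_of R s (q i) *
        (sign_of R s j * sign_of R s (q j))) = 0.
    move=> iJ jJ ij cij; apply: (@sign_avg_odd _ _ [set i]) => s.
    rewrite !sign_of_flip !inE eqxx expr1 qNid// (eq_sym j) (negbTE ij) !expr0.
    have -> : (q j == i) = false.
      apply/negP => /eqP qji; have := cq jJ; rewrite qji => {qji} cE.
      by move: delta_gt0 cij cE => ? ? ?; lra.
    by rewrite !expr0; lra.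
  move=> i j iJ jJ ij; have [cij|cji] := leP (c i) (c j); first exact: key.
  rewrite -[RHS](key _ _ jJ iJ); [|by rewrite eq_sym|exact: ltW].
  by apply: eq_sign_avg => s; rewrite mulrC.
rewrite [leRHS](_ : _ = 1 / 4 * (Num.sqrt #|J|%:R + Num.sqrt #|J|%:R +
  Num.sqrt #|J|%:R)); last by lra.
apply: (@le_trans _ _ (1 / 4 * (sign_avg (fun s =>
  `|\sum_(i in J) sign_of R s i|) +
  sign_avg (fun s => `|\sum_(i in J) sign_of R s (q i)|) +
  sign_avg (fun s => `|\sum_(i in J) sign_of R s i * sign_of R s (q i)|))));
    last first.
  by rewrite ler_pM2l//; lra.
rewrite -!sign_avgD -sign_avgZ; apply: ler_sign_avg => s.
rewrite (_ : _ - _ = 1 / 4 * (eps * (\sum_(i in J) sign_of R s i) + eps2 *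
  (\sum_(i in J) sign_of R s (q i))
   + (eps * eps2) * (\sum_(i in J) sign_of R s i * sign_of R s (q i))));
     last first.
  rewrite -sumr_const !mulr_sumr -!big_split/= mulr_sumr mulr_suml -sumrB.
  by apply: eq_bigr => i _; lra.
rewrite normrM [X in X * _ <= _]ger0_norm; last by lra.
rewrite ler_pM2l; last by lra.
apply: (le_trans (ler_normD _ _)); apply: lerD.
  by apply: (le_trans (ler_normD _ _)); rewrite !normrM E1 E2 !mul1r.
by rewrite !normrM E1 E2 !mul1r.
Qed.

(** By [swap], the averages of [h] weighted by the two pattern counts agree. Replacing each count by
    its mean [#|J| / 4] costs [3 / 4 * sqrt #|J|], and dividing the total by [#|J| / 4] leaves
    [6 / sqrt #|J|]. *)
Lemma sign_avg_shift :
  `|sign_avg (fun s => h (S s + 2 * delta)) - sign_avg (fun s =>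
    h (S s))| * Num.sqrt #|J|%:R <= 6.
Proof.
have [->|J0] := eqVneq J finset.set0; first by rewrite cards0 sqrtr0 mulr0.
set r := Num.sqrt _; have r0 : 0 < r by rewrite sqrtr_gt0 ltr0n card_gt0.
have rr : #|J|%:R = r * r :> R by rewrite -expr2 sqr_sqrtr.
have d0 : sign_avg (fun s => `|\sum_(i in J) e0 i s - #|J|%:R / 4|) <=
  3 / 4 * r.
  have := @pattern_deviation (-1) 1 (normrN1 _) (normr1 _); apply: le_trans.
  rewrite le_eqVlt (_ : _ == _)//; apply/eqP/eq_sign_avg => s.
  by congr `|_ - _|; apply: eq_bigr => i _; rewrite /e0 mulN1r mul1r.
have d1 : sign_avg (fun s => `|\sum_(i in J) e1 i s - #|J|%:R / 4|) <=
  3 / 4 * r.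
  have := @pattern_deviation 1 (-1) (normr1 _) (normrN1 _); apply: le_trans.
  rewrite le_eqVlt (_ : _ == _)//; apply/eqP/eq_sign_avg => s.
  by congr `|_ - _|; apply: eq_bigr => i _; rewrite /e1 mulN1r mul1r.
have E : sign_avg (fun s => (\sum_(i in J) e1 i s) * h (S s + 2 * delta)) =
         sign_avg (fun s => (\sum_(i in J) e0 i s) * h (S s)).
  under eq_sign_avg do rewrite mulr_suml.
  under [RHS]eq_sign_avg do rewrite mulr_suml.
  by rewrite !sign_avg_sum; apply: eq_bigr => i iJ; exact: swap.
have main : `|r * r / 4 * (sign_avg (fun s => h (S s + 2 * delta)) - sign_avg
  (fun s => h (S s)))| <= 3 / 4 * r + 3 / 4 * r.
  rewrite mulrBr -!sign_avgZ.
  rewrite (_ : _ - _ = sign_avg (fun s => - ((\sum_(i in J) e1 i s - #|J|%:R /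
    4) * h (S s + 2 * delta)) +
     (\sum_(i in J) e0 i s - #|J|%:R / 4) * h (S s))); last first.
    transitivity (sign_avg (fun s => r * r / 4 * h (S s + 2 * delta)) -
       sign_avg (fun s => (\sum_(i in J) e1 i s) * h (S s + 2 * delta)) +
       (sign_avg (fun s => (\sum_(i in J) e0 i s) * h (S s)) -
       sign_avg (fun s => r * r / 4 * h (S s)))); first by rewrite E addrA
         subrK.
    by rewrite -!sign_avgB -sign_avgD; apply: eq_sign_avg => s; rewrite rr; lra.
  apply: (le_trans (ler_norm_sign_avg _)).
  apply: le_trans (lerD d1 d0); rewrite -sign_avgD; apply: ler_sign_avg => s.
  apply: (le_trans (ler_normD _ _)); rewrite normrN !normrM.
  by apply: lerD; rewrite ler_piMr// ger0_norm; case/andP: (h01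
    (S s + 2 * delta)); case/andP: (h01 (S s)).
move: main; rewrite normrM ger0_norm; last by rewrite divr_ge0 ?mulr_ge0 ?ltW.
set x := `|_| => main; rewrite -(ler_pM2l r0); lra.
Qed.

End stein.

Section sign_average_more.
Context (R : rcfType) (I : finType).

Lemma sign_avg_sqr_sum (V : {set I}) (w : I -> R) :
  sign_avg (fun s => (\sum_(i in V) w i * sign_of R s i) ^+ 2) =
    \sum_(i in V) w i ^+ 2.
Proof.
under eq_sign_avg => s do rewrite expr2 mulr_suml.
rewrite sign_avg_sum; apply: eq_bigr => i iV.
under eq_sign_avg => s do rewrite mulr_sumr.
rewrite sign_avg_sum (bigD1 i)//= big1 ?addr0 => [|j /andP[jV ji]].
  by under eq_sign_avg => s do rewrite mulrACA sign_of_sq mulr1;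
    rewrite sign_avg_cst.
apply: (@sign_avg_odd _ _ [set i]) => s.
by rewrite !sign_of_flip !inE eqxx (negbTE ji) expr0 expr1; lra.
Qed.

(** Two independent fair sign vectors remain so after exchanging their coordinates in [V]; this
    exchange is the involution [m2]. *)
Lemma sign_avg_split (V : {set I}) (phi : {ffun I -> bool} -> R) :
  sign_avg phi = sign_avg (fun t => sign_avg (fun s =>
    phi [ffun i => if i \in V then s i else t i])).
Proof.
pose mix (p : {ffun I -> bool} * {ffun I -> bool}) : {ffun I -> bool} :=
  [ffun i => if i \in V then p.2 i else p.1 i].
pose m2 p := (mix p, mix (p.2, p.1)).
have m2K : involutive m2.
  move=> [t s]; congr pair; apply/ffunP => i; rewrite !ffunE /= ?ffunE/=;
  by case: ifP => iV; rewrite /= ?ffunE /= ?iV.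
rewrite -[LHS](@sign_avg_cst R I) /sign_avg -!mulr_suml; congr (_ / _ / _).
rewrite [LHS]exchange_big !pair_bigA/= [RHS](reindex_inj (can_inj m2K))/=.
apply: eq_bigr => -[t s] _ /=; congr phi; apply/ffunP => i; rewrite !ffunE /=.
by case: (i \in V).
Qed.

End sign_average_more.

(** * Signed sums of ranks *)

Section rank_sums.
Context (R : rcfType) (n : nat).
Local Notation N := n.+1.

(** Signs are indexed by ranks, not by observations: site [i] stands for the rank [i.+1]. *)
Definition rsum (U : {set 'I_N}) (s : {ffun 'I_N -> bool}) : R :=
  \sum_(i in U) i.+1%:R * sign_of R s i.

Lemma sign_avg_norm_rsum (V : {set 'I_N}) (c : R) : 0 < c ->
  sign_avg (fun s => `|rsum V s|) <= (c + N%:R ^+ 2 * #|V|%:R / c) / 2.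
Proof.
move=> c0; apply: (@le_trans _ _ (sign_avg (fun s =>
  (c + rsum V s ^+ 2 / c) / 2))).
  by apply: ler_sign_avg => s; exact: ler_norm_amgm.
under eq_sign_avg do rewrite mulrC.
rewrite sign_avgZ sign_avgD sign_avg_cst.
under eq_sign_avg do rewrite mulrC.
rewrite sign_avgZ sign_avg_sqr_sum [2^-1 * _]mulrC [c^-1 * _]mulrC.
rewrite ler_wpM2r ?invr_ge0// lerD2l ler_wpM2r ?invr_ge0 ?(ltW c0)//.
rewrite mulr_natr -sumr_const; apply: ler_sum => i _.
by rewrite -!natrX ler_nat leq_exp2r.
Qed.

(** A site is lost only if it lies outside [U], if [i + d] passes the last rank (at most [d] sites),
    or if [i + d] lies outside [U] (at most [#|~: U|] sites, translation being injective). *)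
Lemma card_shift_sites (U : {set 'I_N}) (d : nat) :
  (N <= #|[set i in U | (i + d < N)%N && (inord (i + d) \in U)]|
        + d + #|~: U| + #|~: U|)%N.
Proof.
set J := [set i in U | _].
pose A := [set i : 'I_N | (N <= i + d)%N].
pose B := [set i : 'I_N | (i + d < N)%N && (inord (i + d) \notin U)].
have cA : (#|A| <= d)%N.
  rewrite -[X in (_ <= X)%N]card_ord -cardsT.
  have /leq_trans -> // : (#|A| <= #|[set (inord (n - j) : 'I_N) | j : 'I_d in
    [set: 'I_d]]|)%N.
    apply: subset_leq_card; apply/fintype.subsetP => i; rewrite inE => iA.
    have id : (n - i < d)%N by have := ltn_ord i; lia.
    apply/imsetP; exists (Ordinal id) => //; apply: val_inj => /=.
    by rewrite inordK; have := ltn_ord i; lia.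
  exact: leq_imset_card.
have cB : (#|B| <= #|~: U|)%N.
  have <- : #|[set (inord (i + d) : 'I_N) | i : 'I_N in B]| = #|B|.
    apply: card_in_imset => i j; rewrite !inE => /andP[iN _] /andP[jN _].
    by move=> /(congr1 val); rewrite /= !inordK// => ij; apply: val_inj => /=;
      lia.
  apply: subset_leq_card; apply/fintype.subsetP => _ /imsetP[i + ->].
  by rewrite !inE => /andP[].
have : (#|[set: 'I_N]| <= #|J :|: (A :|: (~: U :|: B))|)%N.
  apply: subset_leq_card; apply/fintype.subsetP => i _; rewrite !inE.
  by case: (i \in U); case: (ltnP (i + d)) => //= _; case: (_ \in U).
rewrite cardsT card_ord => h.
have [h1 _] := leq_card_setU J (A :|: (~: U :|: B)).
have [h2 _] := leq_card_setU A (~: U :|: B).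
have [h3 _] := leq_card_setU (~: U) B.
apply: (leq_trans h); apply: (leq_trans h1); rewrite -!addnA leq_add2l.
apply: (leq_trans h2); rewrite leq_add//.
by apply: (leq_trans h3); rewrite leq_add2l.
Qed.

Lemma sign_avg_rsum_shift (h : R -> R) (U : {set 'I_N}) (d : nat) :
  (forall x, 0 <= h x <= 1) -> (0 < d)%N -> (4 * d <= N)%N ->
  (8 * #|~: U| <= N)%N ->
  `|sign_avg (fun s => h (rsum U s + 2 * d%:R)) - sign_avg (fun s =>
    h (rsum U s))| *
    Num.sqrt N%:R <= 9.
Proof.
move=> h01 d0 dN uN.
set J := [set i in U | (i + d < N)%N && (inord (i + d) \in U)].
(* [d <= N / 4] and [#|~: U| <= N / 8] leave at least half of the sites. *)
have JN : (N <= 2 * #|J|)%N by have := card_shift_sites U d; rewrite -/J; lia.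
have := @sign_avg_shift R _ (fun i : 'I_N => i.+1%:R) U J (fun i =>
  inord (i + d)) d%:R h h01.
rewrite -/(rsum U) => key.
have {key} : `|sign_avg (fun s => h (rsum U s + 2 * d%:R)) - sign_avg
  (fun s => h (rsum U s))| *
    Num.sqrt #|J|%:R <= 6.
  apply: key.
  - by move=> i; rewrite inE => /andP[].
  - by move=> i; rewrite inE => /and3P[].
  - move=> i j; rewrite !inE => /and3P[_ iN _] /and3P[_ jN _] /(congr1 val).
    by rewrite /= !inordK// => ij; apply: val_inj => /=; lia.
  - move=> i; rewrite inE => /and3P[_ iN _].
    by rewrite inordK// -natrD addSn.
  - by rewrite ltr0n.
(* [3 / 2] bounds the square root of 2 from above, and turns the constant 6 into 9. *)
have : Num.sqrt N%:R <= 3 / 2 * Num.sqrt #|J|%:R :> R.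
  rewrite -(@ler_pXn2r _ 2)// ?nnegrE ?mulr_ge0 ?sqrtr_ge0 ?invr_ge0//.
  rewrite exprMn !sqr_sqrtr ?ler0n//.
  have : N%:R <= 2 * #|J|%:R :> R by rewrite -natrM ler_nat.
  by move=> ?; have : 0 <= #|J|%:R :> R by []; lra.
set D := `|_ - _|; have : 0 <= D by exact: normr_ge0.
move: (Num.sqrt N%:R) (Num.sqrt #|J|%:R) => a b D0 ab Db.
apply: le_trans (_ : D * (3 / 2 * b) <= _); first exact: ler_wpM2l.
lra.
Qed.

(** The translation is composed of [q] steps with [d] and one with [b], each of cost 9. *)
Lemma sign_avg_rsum_shift_steps (U : {set 'I_N}) (d q b : nat) (h : R -> R) :
  (forall x, 0 <= h x <= 1) -> (0 < d)%N -> (4 * d <= N)%N ->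
  (8 * #|~: U| <= N)%N -> (b < d)%N ->
  `|sign_avg (fun s => h (rsum U s + 2 * (q * d + b)%:R)) - sign_avg (fun s =>
    h (rsum U s))| *
    Num.sqrt N%:R <= 9 * q.+1%:R.
Proof.
move=> h01 d0 dN uN bd; elim: q h h01 => [|q IH] h h01.
  have [->|b0] := posnP b.
    rewrite mul0n addn0 mulr0; under eq_sign_avg do rewrite addr0.
    by rewrite subrr normr0 mul0r; lra.
  by rewrite mul0n add0n mulr1; apply: sign_avg_rsum_shift => //; lia.
pose h' x := h (x + 2 * d%:R).
have h'01 x : 0 <= h' x <= 1 by exact: h01.
have := IH h' h'01; have := @sign_avg_rsum_shift h U d h01 d0 dN uN.
have -> : sign_avg (fun s => h (rsum U s + 2 * (q.+1 * d + b)%:R)) =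
          sign_avg (fun s => h' (rsum U s + 2 * (q * d + b)%:R)).
  by apply: eq_sign_avg => s; congr h; rewrite mulSn !natrD; lra.
rewrite -/(h' _) [sign_avg (fun s => h (rsum U s + _))](_ : _ = sign_avg
  (fun s => h' (rsum U s)))//.
move: (sign_avg _) (sign_avg _) (sign_avg _) => x y z xy zx.
have zy : `|x - y| <= `|x - z| + `|z - y|.
  by rewrite -[x - y](subrKA z) ler_normD.
apply: le_trans (_ : (`|x - z| + `|z - y|) * Num.sqrt N%:R <= _).
  by rewrite ler_wpM2r ?sqrtr_ge0.
by rewrite mulrDl -[q.+2]addn1 natrD; lra.
Qed.

(** The longest admissible step is [d = N %/ 4]; as [N <= 8 * d], at most [8 * k / N] full steps are
    needed. *)
Lemma sign_avg_rsum_shift_nat (U : {set 'I_N}) (k : nat) (h : R -> R) :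
  (forall x, 0 <= h x <= 1) -> (8 <= N)%N -> (8 * #|~: U| <= N)%N ->
  `|sign_avg (fun s => h (rsum U s + 2 * k%:R)) - sign_avg (fun s =>
    h (rsum U s))| *
    Num.sqrt N%:R <= 9 * (8 * k%:R / N%:R + 1).
Proof.
move=> h01 N8 uN; pose d := (N %/ 4)%N.
have d0 : (0 < d)%N by rewrite divn_gt0//; lia.
rewrite {1}(divn_eq k d).
apply: (le_trans (@sign_avg_rsum_shift_steps U d (k %/ d)
  (k %% d) h h01 d0 _ uN _)).
- by rewrite /d; lia.
- exact: ltn_pmod.
- rewrite ler_pM2l; last by lra.
  rewrite -natr1 lerD2r ler_pdivlMr ?ltr0n// -!natrM ler_nat.
  have := leq_trunc_div k d; have Nd : (N <= 8 * d)%N by rewrite /d; lia.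
  set w := (k %/ d)%N => wk.
  apply: (@leq_trans (w * (8 * d))%N); first by rewrite leq_mul2l Nd orbT.
  by rewrite mulnCA leq_mul2l.
Qed.

Lemma sign_avg_rsum_shift_even (U : {set 'I_N}) (a b : nat) (h : R -> R) :
  (forall x, 0 <= h x <= 1) -> (8 <= N)%N -> (8 * #|~: U| <= N)%N ->
  `|sign_avg (fun s => h (rsum U s + 2 * (a%:R - b%:R))) - sign_avg (fun s =>
    h (rsum U s))| *
    Num.sqrt N%:R <= 9 * (8 * `|a%:R - b%:R| / N%:R + 1).
Proof.
move=> h01 N8 uN; have [ab|/ltnW ba] := leqP b a.
  rewrite -natrB// [`|(a - b)%:R|]ger0_norm//.
  exact: sign_avg_rsum_shift_nat.
(* A negative translation is undone by a positive one: applied to the translate [h'], the previous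
   bound compares the same two averages in the other order. *)
pose h' x := h (x + 2 * (a%:R - b%:R)).
have := @sign_avg_rsum_shift_nat U (b - a) h' (fun x => h01 _) N8 uN.
rewrite [`|a%:R - b%:R|]distrC natrB// [`|b%:R - a%:R|]ger0_norm ?subr_ge0
  ?ler_nat//.
rewrite distrC.
congr (`|_ - _| * _ <= _); apply: eq_sign_avg => s; rewrite /h'//; congr h; lra.
Qed.

Lemma sign_ofE (s : {ffun 'I_N -> bool}) i : sign_of R s i = 1 - 2 * (s i)%:R.
Proof. by rewrite /sign_of; case: (s i) => /=; rewrite ?expr0 ?expr1; lra. Qed.

(** Flipping a sign changes the sum by twice a rank. Hence freezing or redrawing signs only ever
    causes even translations. *)
Lemma rsumB_even (V : {set 'I_N}) (s t : {ffun 'I_N -> bool}) :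
  exists a b : nat, rsum V s - rsum V t = 2 * (a%:R - b%:R).
Proof.
exists (\sum_(i in V) i.+1 * t i)%N, (\sum_(i in V) i.+1 * s i)%N.
rewrite !natr_sum -!sumrB mulr_sumr; apply: eq_bigr => i _.
by rewrite !sign_ofE !natrM; lra.
Qed.

(** Split the fully fair sum over [U] and its complement. Replacing its fair signs [t'] off [U] by
    the fixed [t] translates the sum over [U] by an even amount, of size at most the sum of the
    absolute values of the two partial sums; the one for [t'] is then averaged. *)
Lemma sign_avg_rsum_smooth (h : R -> R) (U : {set 'I_N}) (t : {ffun 'I_N ->
  bool}) (eta : R) :
  (forall x, 0 <= h x <= 1) -> (8 <= N)%N -> 0 < eta ->
  `|sign_avg (fun s => h (rsum (~: U) t + rsum U s)) - sign_avg (fun s =>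
    h (rsum [set: 'I_N] s))| <=
  8 * #|~: U|%:R / N%:R + 9 / Num.sqrt N%:R +
  36 * `|rsum (~: U) t| / (N%:R * Num.sqrt N%:R) + 18 *
    (eta + #|~: U|%:R / N%:R / eta).
Proof.
move=> h01 N8 eta0.
set u := #|~: U|.
have N0 : 0 < N%:R :> R by rewrite ltr0n.
have r0 : 0 < Num.sqrt N%:R :> R by rewrite sqrtr_gt0.
set r := Num.sqrt N%:R in r0 *.
have rr : N%:R = r * r :> R by rewrite -expr2 sqr_sqrtr ?ler0n.
have u0 : 0 <= u%:R :> R by [].
have p1 : 0 <= 9 / r by rewrite divr_ge0 ?ltW.
have p2 : 0 <= 36 * `|rsum (~: U) t| / (N%:R * r).
  by rewrite divr_ge0 ?mulr_ge0// ltW.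
have p3 : 0 <= 18 * (eta + u%:R / N%:R / eta).
  by rewrite mulr_ge0 ?addr_ge0 ?divr_ge0// ltW.
(* If more than an eighth of the signs are fixed, the first term of the bound is already at least
   1. *)
have [uN|uN] := leqP (8 * u) N; last first.
  have : 1 <= 8 * u%:R / N%:R :> R.
    by rewrite ler_pdivlMr// mul1r -natrM ler_nat ltnW.
  move=> u1; apply: (@le_trans _ _ 1); last first.
    by rewrite -!addrA; apply: (le_trans u1); rewrite lerDl !addr_ge0.
  rewrite -sign_avgB; apply: (le_trans (ler_norm_sign_avg _)).
  rewrite -[leRHS](@sign_avg_cst _ 'I_N); apply: ler_sign_avg => s.
  have /andP[? ?] := h01 (rsum (~: U) t + rsum U s).
  have /andP[? ?] := h01 (rsum [set: 'I_N] s).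
  by rewrite ler_norml; lra.
rewrite [X in _ - X](sign_avg_split U).
rewrite -[X in X - _](@sign_avg_cst R 'I_N) -sign_avgB.
apply: (le_trans (ler_norm_sign_avg _)).
have step (t' : {ffun 'I_N -> bool}) : `|sign_avg (fun s =>
  h (rsum (~: U) t + rsum U s)) -
   sign_avg (fun s => h (rsum [set: 'I_N] [ffun i =>
     if i \in U then s i else t' i]))| <=
   (9 / r + 36 * `|rsum (~: U) t| / (N%:R * r)) + 36 / (N%:R * r) * `|rsum
     (~: U) t'|.
  have [a [b ab]] := rsumB_even (~: U) t t'.
  pose h' x := h (x + rsum (~: U) t').
  have := @sign_avg_rsum_shift_even U a b h' (fun x => h01 _) N8 uN.
  have -> : sign_avg (fun s => h' (rsum U s + 2 * (a%:R - b%:R))) =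
      sign_avg (fun s => h (rsum (~: U) t + rsum U s)).
    by apply: eq_sign_avg => s; rewrite /h' -ab; congr h; lra.
  have -> : sign_avg (fun s => h' (rsum U s)) =
    sign_avg (fun s => h (rsum [set: 'I_N] [ffun i =>
      if i \in U then s i else t' i])).
    apply: eq_sign_avg => s; rewrite /h'; congr h.
    rewrite /rsum [RHS](bigID (fun i => i \in U))/=; congr (_ + _).
      apply: eq_big => i; first by rewrite finset.in_setT.
      by move=> iU; rewrite /sign_of ffunE iU.
    apply: eq_big => i; first by rewrite finset.in_setT inE.
    by rewrite inE => /negbTE iU; rewrite /sign_of ffunE iU.
  rewrite -/r; set A := `|_ - _|; move=> h1.
  have ab2 : `|a%:R - b%:R| <= (`|rsum (~: U) t| + `|rsum (~: U) t'|) / 2 :> R.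
    rewrite ler_pdivlMr// -[X in _ * X]ger0_norm// -normrM mulrC -ab.
    exact: ler_normB.
  have {h1} : A * r <= 9 * (8 * ((`|rsum (~: U) t| + `|rsum
    (~: U) t'|) / 2) / N%:R + 1).
    apply: (le_trans h1); rewrite ler_pM2l// lerD2r ler_pM2r ?invr_gt0//
      ler_pM2l//.
  rewrite -ler_pdivlMr// => h2; apply: (le_trans h2); rewrite le_eqVlt;
    apply/orP; left; apply/eqP.
  move: {h2} (N%:R : R) N0 => M M0.
  by field; rewrite (gt_eqF M0) (gt_eqF r0).
apply: (@le_trans _ _ (9 / r + 36 * `|rsum (~: U) t| / (N%:R * r) +
   36 / (N%:R * r) * sign_avg (fun t' => `|rsum (~: U) t'|))).
  rewrite -sign_avgZ -[X in _ <= X + _](@sign_avg_cst _ 'I_N) -sign_avgD.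
  exact: ler_sign_avg.
(* This [c] balances scales: after multiplication by [36 / (N * r)], the mean of the partial sum for
   [t'] costs [18 * eta] plus [18 * u / (N * eta)]. *)
have c0 : 0 < N%:R * r * eta by rewrite !mulr_gt0.
have := sign_avg_norm_rsum (~: U) c0; rewrite -/u; set y := sign_avg _ => yb.
have : 36 / (N%:R * r) * y <= 18 * (eta + u%:R / N%:R / eta).
  apply: le_trans (_ : 36 / (N%:R * r) * ((N%:R * r * eta +
    N%:R ^+ 2 * u%:R / (N%:R * r * eta)) / 2) <= _).
    by rewrite ler_wpM2l// divr_ge0 ?mulr_ge0 ?ltW.
  rewrite le_eqVlt; apply/orP; left; apply/eqP; rewrite rr; field.
  by rewrite !gt_eqF.
have : 0 <= 8 * u%:R / N%:R :> R by rewrite divr_ge0 ?mulr_ge0.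
move: (8 * u%:R / N%:R) (18 * (eta + _)) (9 / r) (36 * `|_| / _) (_ / _ * y).
by move=> e1 e2 e3 e4 e5 ? ?; lra.
Qed.

End rank_sums.

(** * The statistic in the absence of ties *)

Section signed_rank_no_ties.
Context (R : realType) (n : nat) (x : 'I_n -> R).
Hypothesis x_inj : injective (fun i => `|x i|).

Let r : rel 'I_n := fun i j => `|x j| <= `|x i|.
Let tau (k : 'I_n) : 'I_n := tnth (abs_order x) k.

Let tau_inj : injective tau.
Proof.
have : uniq (abs_order x) by rewrite /abs_order sort_uniq val_ord_tuple
  enum_uniq.
by move/tuple_uniqP.
Qed.

Let tau_r (k k' : 'I_n) : (k <= k')%N -> r (tau k) (tau k').
Proof.
move=> kk'; rewrite /tau !(tnth_nth k).
have r_trans : transitive r by move=> a b c; rewrite /r => ba cb;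
  exact: le_trans cb ba.
apply: (@sorted_leq_nth _ r) => //.
- by move=> a; rewrite /r.
- by apply: sort_sorted => a b; rewrite /r le_total.
- by rewrite inE size_tuple.
- by rewrite inE size_tuple.
Qed.

(** Without ties, the absolute values not exceeding the one at position [k] are those at positions
    [k] and later. The weight [n - k] of the statistic is thus a rank. *)
Let card_tau (k : 'I_n) : #|[set j | `|x j| <= `|x (tau k)|]| = (n - k)%N.
Proof.
have -> : [set j | `|x j| <= `|x (tau k)|] = tau @: [set k' : 'I_n |
  (k <= k')%N].
  apply/setP => j; rewrite inE; apply/idP/imsetP => [jk|[k' + ->]]; last first.
    by rewrite inE; exact: tau_r.
  exists (invF tau_inj j); last by rewrite f_invF.
  rewrite inE leqNgt; apply/negP => lt_jk.
  have := tau_r (ltnW lt_jk); rewrite /r f_invF => kj.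
  have /x_inj jE : `|x j| = `|x (tau k)| by apply/eqP; rewrite eq_le jk.
  by move: lt_jk; rewrite jE invF_f ltnn.
rewrite card_imset//; have := cardsC [set k' : 'I_n | (k <= k')%N];
  rewrite card_ord.
have -> : ~: [set k' : 'I_n | (k <= k')%N] = [set k' : 'I_n | (k' < k)%N].
  by apply/setP => k'; rewrite !inE ltnNge.
have -> : #|[set k' : 'I_n | (k' < k)%N]| = k.
  have kn := ltnW (ltn_ord k).
  have -> : [set k' : 'I_n | (k' < k)%N] = (widen_ord kn) @: [set: 'I_k].
    apply/setP => k'; rewrite inE; apply/idP/imsetP => [h|[i _ ->]];
      last exact: (ltn_ord i).
    by exists (Ordinal h) => //; exact: val_inj.
  rewrite card_imset ?cardsT ?card_ord// => a b /(congr1 val) /= ab.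
  exact: val_inj.
by move=> h; apply: (@addIn k); rewrite subnK ?(ltnW (ltn_ord k)).
Qed.

Let sum_boolE (P : pred 'I_n) : (\sum_j (P j : nat))%N = #|[set j | P j]|.
Proof.
by rewrite -sum1dep_card [RHS]big_mkcond; apply: eq_bigr => j _; case: (P j).
Qed.

Lemma abs_rank_perm : exists2 s : 'I_n -> 'I_n, injective s &
  forall i, (\sum_j (`|x j| <= `|x i|)%R%:R : R) = (s i).+1%:R.
Proof.
exists (fun i => rev_ord (invF tau_inj i)) => [i j /rev_ord_inj|i].
  exact: (can_inj (f_invF tau_inj)).
rewrite -natr_sum; congr (_%:R).
rewrite -(f_invF tau_inj i) invF_f; set k := invF _ _.
by rewrite (sum_boolE (fun j => `|x j| <= `|x (tau k)|)) card_tau /= subnSK.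
Qed.

Lemma signed_rank_no_ties :
  signed_rank x = \sum_i (\sum_j (`|x j| <= `|x i|)%R%:R) * Num.sg (x i).
Proof.
rewrite [RHS](reindex_inj tau_inj) /signed_rank; apply: eq_bigr => k _.
congr (_ * _); rewrite -(card_tau k) -natr_sum; congr (_%:R).
by rewrite (sum_boolE (fun j => `|x j| <= `|x (tau k)|)).
Qed.

End signed_rank_no_ties.

Local Open Scope classical_set_scope.

(** * Bounded measurable functions and product laws *)

Section bounded_measurable.
Context d (T : measurableType d) (R : realType).
Implicit Types f g : T -> R.

(** Such functions are integrable under every probability, so integrability side conditions reduce
    to closure properties of this class. *)
Definition bounded_mfun f := measurable_fun setT f /\ exists M, forall x,
  `|f x| <= M.

Lemma bounded_mfun_meas f : bounded_mfun f -> measurable_fun setT f. Proof. by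
  case. Qed.

Lemma bounded_mfun_cst (c : R) : bounded_mfun (cst c).
Proof. by split => //; exists `|c|. Qed.

Lemma bounded_mfunD f g : bounded_mfun f -> bounded_mfun g ->
  bounded_mfun (fun x => f x + g x).
Proof.
move=> [mf [M fM]] [mg [N gN]]; split; first exact: measurable_funD.
by exists (M + N) => x; apply: (le_trans (ler_normD _ _)); exact: lerD.
Qed.

Lemma bounded_mfunN f : bounded_mfun f -> bounded_mfun (fun x => - f x).
Proof.
move=> [mf [M fM]]; split; first exact: measurable_funN.
by exists M => x; rewrite normrN.
Qed.

Lemma bounded_mfunB f g : bounded_mfun f -> bounded_mfun g ->
  bounded_mfun (fun x => f x - g x).
Proof. by move=> bf bg; apply: bounded_mfunD => //; exact: bounded_mfunN. Qed.

Lemma bounded_mfunM f g : bounded_mfun f -> bounded_mfun g ->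
  bounded_mfun (fun x => f x * g x).
Proof.
move=> [mf [M fM]] [mg [N gN]]; split; first exact: measurable_funM.
by exists (M * N) => x; rewrite normrM; exact: ler_pM.
Qed.

Lemma bounded_mfunZ c f : bounded_mfun f -> bounded_mfun (fun x => c * f x).
Proof. by move=> bf; apply: bounded_mfunM => //; exact: bounded_mfun_cst. Qed.

Lemma bounded_mfun_norm f : bounded_mfun f -> bounded_mfun (fun x => `|f x|).
Proof.
move=> [mf [M fM]]; split; first exact: measurableT_comp.
by exists M => x; rewrite normr_id.
Qed.

Lemma bounded_mfunX f n : bounded_mfun f -> bounded_mfun (fun x => f x ^+ n).
Proof.
move=> [mf [M fM]]; split; first exact: measurable_funX.
by exists (M ^+ n) => x; rewrite normrX lerXn2r// nnegrE ?(le_trans _ (fM x)).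
Qed.

Lemma bounded_mfun_sum (I : Type) (r : seq I) (P : pred I) (f : I -> T -> R) :
  (forall i, bounded_mfun (f i)) -> bounded_mfun (fun x =>
    \sum_(i <- r | P i) f i x).
Proof.
move=> bf; elim: r => [|i r IH].
  by under eq_fun do rewrite big_nil; exact: bounded_mfun_cst.
under eq_fun do rewrite big_cons; case: (P i) => //.
exact: bounded_mfunD.
Qed.

Lemma bounded_mfun_indic (A : set T) : measurable A ->
  bounded_mfun (\1_A : T -> R).
Proof.
move=> mA; split; first exact: measurable_indic.
by exists 1 => x; rewrite indicE; case: (_ \in _); rewrite ?normr0 ?normr1.
Qed.

End bounded_measurable.

Lemma bounded_mfun_comp d d' (T : measurableType d) (T' : measurableType d')
    (R : realType) (h : T' -> T) (f : T -> R) :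
  measurable_fun setT h -> bounded_mfun f -> bounded_mfun (f \o h).
Proof.
move=> mh [mf [M fM]]; split; last by exists M => x /=.
exact: measurableT_comp.
Qed.

Section probability_expectation.
Context d (T : measurableType d) (R : realType) (P : probability T R).
Implicit Types f g : T -> R.

Lemma bounded_mfun_integrable f : bounded_mfun f ->
  P.-integrable setT (EFin \o f).
Proof.
move=> [mf [M fM]]; apply: measurable_bounded_integrable => //.
  by rewrite /= probability_setT ltry.
exists M; split; first exact: num_real.
by move=> x Mx y _ /=; exact: le_trans (fM y) (ltW Mx).
Qed.

Lemma Rint_cst (c : R) : \int[P]_x c = c.
Proof. by rewrite Rintegral_cst//= probability_setT mulr1. Qed.

Lemma RintD f g : bounded_mfun f -> bounded_mfun g ->
  \int[P]_x (f x + g x) = \int[P]_x f x + \int[P]_x g x.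
Proof. by move=> bf bg; rewrite RintegralD//; exact: bounded_mfun_integrable.
  Qed.

Lemma RintB f g : bounded_mfun f -> bounded_mfun g ->
  \int[P]_x (f x - g x) = \int[P]_x f x - \int[P]_x g x.
Proof. by move=> bf bg; rewrite RintegralB//; exact: bounded_mfun_integrable.
  Qed.

Lemma RintZ c f : bounded_mfun f -> \int[P]_x (c * f x) = c * \int[P]_x f x.
Proof. by move=> bf; rewrite RintegralZl//; exact: bounded_mfun_integrable. Qed.

Lemma le_Rint f g : bounded_mfun f -> bounded_mfun g -> (forall x,
  f x <= g x) ->
  \int[P]_x f x <= \int[P]_x g x.
Proof. by move=> bf bg fg; rewrite le_Rintegral//;
  exact: bounded_mfun_integrable. Qed.

Lemma eq_Rint f g : f =1 g -> \int[P]_x f x = \int[P]_x g x.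
Proof. by move=> fg; apply: eq_Rintegral => x _. Qed.

Lemma Rint_sum (I : Type) (r : seq I) (Q : pred I) (f : I -> T -> R) :
  (forall i, bounded_mfun (f i)) ->
  \int[P]_x (\sum_(i <- r | Q i) f i x) = \sum_(i <- r | Q i) \int[P]_x f i x.
Proof.
move=> bf; elim: r => [|i r IH].
  by under eq_Rint do rewrite big_nil; rewrite big_nil Rint_cst.
under eq_Rint do rewrite big_cons; rewrite big_cons; case: (Q i) => //.
by rewrite RintD// ?IH//; exact: bounded_mfun_sum.
Qed.

Lemma le_norm_Rint f : bounded_mfun f -> `|\int[P]_x f x| <= \int[P]_x `|f x|.
Proof. by move=> bf; rewrite le_normr_Rintegral//;
  exact: bounded_mfun_integrable. Qed.

Lemma Rint_indic (A : set T) : measurable A -> \int[P]_x \1_A x = fine (P A).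
Proof. by move=> mA; rewrite /Rintegral integral_indic// setIT. Qed.

Lemma le_Rint_ae (N : set T) f g : measurable N -> P N = 0%E ->
  bounded_mfun f -> bounded_mfun g -> (forall x, ~ N x -> f x <= g x) ->
  \int[P]_x f x <= \int[P]_x g x.
Proof.
move=> mN N0 bf bg fg; have [mf [M fM]] := bf; have [mg [M' gM]] := bg.
(* Adding [(M + M') * \1_N] to [g] makes the inequality hold everywhere and leaves the integral of
   [g] unchanged. *)
have bN : bounded_mfun (fun x => (M + M') * \1_N x : R) by apply:
  bounded_mfunZ; exact: bounded_mfun_indic.
rewrite -[leRHS]addr0 -[X in _ + X](mulr0 (M + M')) -[X in _ * X](_ : fine
  (P N) = 0); last first.
  by rewrite N0.
rewrite -Rint_indic// -RintZ; last exact: bounded_mfun_indic.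
rewrite -RintD//; apply: le_Rint => //; first exact: bounded_mfunD.
move=> x; rewrite indicE; have [/set_mem Nx|/negP Nx] := boolP (x \in N).
  have := fM x; have := gM x; rewrite !ler_norml => /andP[? ?] /andP[? ?].
  by rewrite mulr1; lra.
by rewrite mulr0 addr0; apply: fg => ?; apply: Nx; exact/mem_set.
Qed.

Lemma markov_Rint f (c : R) : 0 < c -> bounded_mfun f -> (forall x, 0 <= f x) ->
  fine (P [set x | c <= f x]) <= \int[P]_x f x / c.
Proof.
move=> c0 bf f0.
have mA : measurable [set x | c <= f x].
  rewrite (_ : [set _ | _] = f @^-1` `[c, +oo[); last first.
    by apply/seteqP; split => x /=; rewrite in_itv/= andbT.
  by rewrite -[X in measurable X]setTI; apply: bf.1.
rewrite -Rint_indic// ler_pdivlMr// mulrC -RintZ; last exact: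
  bounded_mfun_indic.
apply: le_Rint => //; first by apply: bounded_mfunZ; exact: bounded_mfun_indic.
move=> x; rewrite indicE; have [/set_mem/=|_] := boolP (x \in _);
  last by rewrite mulr0.
by rewrite mulr1.
Qed.

End probability_expectation.

Lemma Rint_eq_measure d (T : measurableType d) (R : realType)
    (P Q : {measure set T -> \bar R}) (f : T -> R) :
  (forall A, measurable A -> P A = Q A) -> \int[P]_x f x = \int[Q]_x f x.
Proof. by move=> PQ; congr fine; apply: eq_measure_integral => A mA _;
  exact: PQ. Qed.

Lemma Rint_distribution d d' (T : measurableType d) (T' : measurableType d')
    (R : realType) (P : probability T R) (X : {mfun T >-> T'}) (f : T' -> R) :
  bounded_mfun f -> \int[distribution P X]_y f y = \int[P]_x f (X x).
Proof.
move=> bf; congr fine; rewrite integral_distribution//.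
  exact/measurable_EFinP/bounded_mfun_meas.
apply: (@bounded_mfun_integrable _ _ _ P (f \o X)).
by apply: bounded_mfun_comp.
Qed.

Lemma Rint_prod d1 d2 (T1 : measurableType d1) (T2 : measurableType d2)
    (R : realType) (P1 : probability T1 R) (P2 : probability T2 R)
      (f : T1 * T2 -> R) :
  bounded_mfun f ->
  bounded_mfun (fun x => \int[P2]_y f (x, y)) /\
  \int[(P1 \x P2)%E]_z f z = \int[P1]_x \int[P2]_y f (x, y).
Proof.
move=> bf; have intf := bounded_mfun_integrable (P1 \x P2)%E bf.
have bfx x : bounded_mfun (fun y => f (x, y)).
  by apply: (bounded_mfun_comp _ bf); exact: pair1_measurable.
have E x : (\int[P2]_y f (x, y))%:E = (\int[P2]_y (f (x, y))%:E)%E.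
  rewrite /Rintegral fineK//; apply: integrable_fin_num => //.
  exact: bounded_mfun_integrable (bfx x).
split.
  split; last first.
    have [mf [M fM]] := bf; exists M => x.
    apply: (le_trans (le_norm_Rint _ (bfx x))).
    rewrite -[leRHS](Rint_cst P2); apply: le_Rint => //;
      first exact: bounded_mfun_norm.
    exact: bounded_mfun_cst.
  apply/measurable_EFinP; rewrite (_ : _ \o _ = fubini_F P2 (EFin \o f)).
    exact: (measurable_fubini_F intf).
  by apply/funext => x /=; rewrite E.
rewrite {1}/Rintegral -(integral12_prod_meas1 intf); congr fine.
by apply: eq_integral => x _; rewrite E.
Qed.

(** * Product laws and resampling of one coordinate *)

Section product_law.
Context d (Z : measurableType d) (R : realType).

Definition box n (B : 'I_n -> set Z) : set (n.-tuple Z) :=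
  [set y | forall i, B i (tnth y i)].

Definition is_product_law n (L : probability Z R) (Q : probability
  (n.-tuple Z) R) :=
  forall B : 'I_n -> set Z, (forall i, measurable (B i)) ->
    Q (box B) = (\prod_(i < n) L (B i))%E.

Lemma measurable_box n (B : 'I_n -> set Z) :
  (forall i, measurable (B i)) -> measurable (box B).
Proof.
move=> mB; rewrite (_ : box B = \bigcap_(i in [set: 'I_n])
  ((@tnth n Z)^~ i @^-1` B i)).
  apply: fin_bigcap_measurable => // i _.
  by rewrite -[X in measurable X]setTI; apply: measurable_tnth.
by apply/seteqP; split => y /= h i; [move=> _|]; exact: h.
Qed.

(** Boxes are stable under intersection and generate the product sigma-algebra, a cylinder being a
    box whose other sides are full. *)
Lemma box_unique n (Q1 Q2 : probability (n.-tuple Z) R) :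
  (forall B, (forall i, measurable (B i)) -> Q1 (box B) = Q2 (box B)) ->
  forall A, measurable A -> Q1 A = Q2 A.
Proof.
move=> QQ A mA.
pose G := [set C : set (n.-tuple Z) | exists2 B, (forall i,
  measurable (B i)) & C = box B].
have boxT : setT = box (fun=> setT) :> set (n.-tuple Z) by apply/seteqP; split.
apply: (measure_unique G (fun=> setT)) => //.
- apply/seteqP; split; last first.
    apply: smallest_sub; first exact: sigma_algebra_measurable.
    by move=> _ [B mB ->]; exact: measurable_box.
  apply: smallest_sub; first exact: smallest_sigma_algebra.
  rewrite -bigcup_seq => C [i _ [B mB <-]]; apply: sub_sigma_algebra.
  exists (fun j => if j == i then B else setT).
    by move=> j; case: ifP.
  apply/seteqP; split => y /=.
    by move=> [_ yB] j; case: eqP => [->|].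
  by move=> /(_ i); rewrite eqxx.
- move=> _ _ [B mB ->] [C mC ->]; exists (fun i => B i `&` C i).
    by move=> i; exact: measurableI.
  apply/seteqP; split => y /=; first by move=> [yB yC] i; split.
  by move=> h; split => i; case: (h i).
- by move=> _; exists (fun=> setT).
- by rewrite bigcup_const//; exists 0%N.
- by move=> _ [B mB ->]; exact: QQ.
- by move=> k; rewrite /= probability_setT ltry.
Qed.

Lemma product_law_ex (L : probability Z R) n :
  exists Q : probability (n.-tuple Z) R, is_product_law L Q.
Proof.
elim: n => [|n [Q QL]].
  exists [the probability _ _ of \d_([tuple] : 0.-tuple Z)] => B mB /=.
  by rewrite big_ord0 diracE mem_set// => -[].
pose c (p : Z * n.-tuple Z) : n.+1.-tuple Z := [the n.+1.-tuple Z of p.1 ::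
  p.2].
have mc : measurable_fun setT c by exact: measurable_cons.
pose X : {mfun (Z * n.-tuple Z)%type >-> n.+1.-tuple Z} :=
  mfun_Sub (mem_set mc).
exists [the probability _ _ of distribution (L \x Q)%E X] => B mB /=.
rewrite /distribution /pushforward.
rewrite [X in (_ \x _)%E X](_ : _ = B ord0 `*` box (fun i => B (lift ord0 i))).
  rewrite product_measure1E//; last exact: measurable_box.
  rewrite big_ord_recl; congr (_ * _)%E.
  exact: (@QL (fun i => B (lift ord0 i))).
apply/seteqP; split => -[x y] /=.
  move=> h; split; first exact: (h ord0).
  by move=> i; have := h (lift ord0 i); rewrite tnthS.
move=> [h0 h] i; case: (unliftP ord0 i) => [j|] ->; last exact: h0.
by rewrite tnthS; exact: h.
Qed.

Definition tupd n (y : n.-tuple Z) (l : 'I_n) (x : Z) : n.-tuple Z :=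
  [tuple if i == l then x else tnth y i | i < n].

Lemma measurable_tupd n (l : 'I_n) :
  measurable_fun setT (fun p : n.-tuple Z * Z => tupd p.1 l p.2).
Proof.
apply/measurable_fun_tnthP => i.
rewrite (_ : _ \o _ = fun p : n.-tuple Z * Z => if i == l then p.2 else tnth
  p.1 i).
  case: (i == l); first exact: measurable_snd.
  by apply: (measurableT_comp (measurable_tnth i)); exact: measurable_fst.
by apply/funext => p /=; rewrite tnth_mktuple.
Qed.

Section resample.
Context n (L : probability Z R) (Q : probability (n.-tuple Z) R).
Hypothesis QL : is_product_law L Q.

Lemma resample_law (l : 'I_n) (A : set (n.-tuple Z)) : measurable A ->
  Q A = (Q \x L)%E [set p | A (tupd p.1 l p.2)].
Proof.
pose X : {mfun (n.-tuple Z * Z)%type >-> n.-tuple Z} :=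
  mfun_Sub (mem_set (measurable_tupd l)).
move: A; apply: (@box_unique n Q [the probability _ _ of distribution
  (Q \x L)%E X]) => B mB /=.
rewrite /distribution /pushforward.
rewrite [X in (_ \x _)%E X](_ : _ = box (fun i => if i == l then setT else B
  i) `*` B l).
  rewrite product_measure1E//; last first.
    by apply: measurable_box => i; case: ifP.
  rewrite QL// [X in _ = (X * _)%E](@QL (fun i => if i == l then setT else B
    i)); last first.
    by move=> i; case: ifP.
  rewrite (bigD1 l)//= [in RHS](bigD1 l)//= eqxx probability_setT mul1e muleC.
  by congr (_ * _)%E; apply: eq_bigr => i /negbTE ->.
apply/seteqP; split => -[y x] /= h.
  split; last by have := h l; rewrite tnth_mktuple eqxx.
  by move=> i; have := h i; rewrite tnth_mktuple; case: eqP.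
case: h => h hl i; rewrite tnth_mktuple; have := h i.
by case: eqP => [->|].
Qed.

(** Takes the place of conditioning on all coordinates but [l]: the inner integral averages that
    coordinate alone. *)
Lemma resample_Rint (l : 'I_n) (f : n.-tuple Z -> R) : bounded_mfun f ->
  \int[Q]_y f y = \int[Q]_y \int[L]_x f (tupd y l x).
Proof.
move=> bf; pose X : {mfun (n.-tuple Z * Z)%type >-> n.-tuple Z} :=
  mfun_Sub (mem_set (measurable_tupd l)).
rewrite (@Rint_eq_measure _ _ _ Q (distribution (Q \x L)%E X)); last first.
  by move=> A mA; exact: resample_law.
rewrite Rint_distribution//.
by have [_ ->] := Rint_prod Q L (bounded_mfun_comp (measurable_tupd l) bf).
Qed.

End resample.

(** The maps may differ between coordinates, so any fixed pattern of sign flips is covered. *)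
Lemma product_law_map n (L : probability Z R) (Q : probability (n.-tuple Z) R)
    (theta : 'I_n -> Z -> Z) : is_product_law L Q ->
  (forall i, measurable_fun setT (theta i)) ->
  (forall i B, measurable B -> L (theta i @^-1` B) = L B) ->
  forall f : n.-tuple Z -> R, bounded_mfun f ->
    \int[Q]_y f y = \int[Q]_y f [tuple theta i (tnth y i) | i < n].
Proof.
move=> QL mt tL f bf.
have mm : measurable_fun setT (fun y : n.-tuple Z =>
  [tuple theta i (tnth y i) | i < n]).
  apply/measurable_fun_tnthP => i.
  rewrite (_ : _ \o _ = theta i \o (@tnth n Z)^~ i); last first.
    by apply/funext => p /=; rewrite tnth_mktuple.
  by apply: measurableT_comp => //; exact: measurable_tnth.
pose X : {mfun n.-tuple Z >-> n.-tuple Z} := mfun_Sub (mem_set mm).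
rewrite (@Rint_eq_measure _ _ _ Q (distribution Q X)) ?Rint_distribution//.
apply: box_unique => B mB /=; rewrite /distribution /pushforward.
rewrite [X in _ = Q X](_ : _ = box (fun i => theta i @^-1` B i)).
  rewrite !QL//; first by apply: eq_bigr => i _; rewrite tL.
  by move=> i; rewrite -[X in measurable X]setTI; exact: mt.
by apply/seteqP; split => y /= h i; have := h i; rewrite tnth_mktuple.
Qed.

End product_law.

(** * Laws on the real line *)

Section laws_on_R.
Context (R : realType).
Implicit Types p q : probability R R.

Lemma law_unique p q : (forall x : R, p `]-oo, x]%classic = q `]-oo,
  x]%classic) ->
  forall A, measurable A -> p A = q A.
Proof.
move=> pq A mA.
have pqo x : p `]x, +oo[%classic = q `]x, +oo[%classic.
  by rewrite -setCitvl !probability_setC//= pq.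
apply: (measure_unique (@RGenOInfty.G R) (fun k => `]- k%:R,
  +oo[%classic)) => //.
- exact: RGenOInfty.measurableE.
- move=> _ _ [x ->] [y ->]; exists (Num.max x y).
  by apply/seteqP; split => z /=; rewrite !in_itv/= !andbT gt_max => /andP.
- by move=> k; exists (- k%:R).
- apply/seteqP; split => // x _; exists (Num.trunc (- x)).+1 => //=.
  rewrite in_itv/= andbT ltrNl; exact: truncnS_gt.
- by move=> _ [x ->]; exact: pqo.
- by move=> k; rewrite ltey_eq fin_num_measure.
Qed.

Definition no_atom p := forall x : R, p [set x] = 0%E.

Section density.
Context (F : cumulativeBounded (0 : R) (1 : R)) (f : R -> R).
Hypothesis Ff : is_density F f.

Local Notation mu := (@lebesgue_measure R).
Local Notation TR := (measurableTypeR R).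

Let nu (A : set TR) : \bar R := (\int[mu]_(x in A) (f x)%:E)%E.

Let f_ge0 x : (0 <= (f x)%:E)%E. Proof. by case: Ff => _ f0 _;
  rewrite lee_fin. Qed.
Let mf : measurable_fun [set: TR] (EFin \o f). Proof. by case: Ff => mf _ _;
  exact/measurable_EFinP. Qed.

Let nu0 : nu set0 = 0%E. Proof. by rewrite /nu integral_set0. Qed.
Let nu_ge0 A : (0 <= nu A)%E. Proof. by apply: integral_ge0. Qed.
Let nu_sa : semi_sigma_additive nu.
Proof. exact: semi_sigma_additive_nng_induced. Qed.

HB.instance Definition _ := isMeasure.Build _ _ _ nu nu0 nu_ge0 nu_sa.

Let nuT : nu setT = 1%E.
Proof.
have h1 : nu `]-oo, n%:R]%classic @[n --> \oo] --> nu setT.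
  rewrite (_ : setT = \bigcup_n `]-oo, (n%:R : R)]%classic).
    apply: nondecreasing_cvg_mu => //.
      by apply: bigcup_measurable => n _.
    move=> m n mn; apply/subsetPset; apply: subset_itvl.
    by rewrite bnd_simp ler_nat.
  apply/seteqP; split => // x _; exists (Num.trunc x).+1 => //=.
  by rewrite in_itv/= ltW// truncnS_gt.
have h2 : nu `]-oo, n%:R]%classic @[n --> \oo] --> 1%E.
  rewrite (_ : (fun n => nu _) = (fun n => (F n%:R)%:E)); last first.
    by apply/funext => n; case: Ff => _ _ ->.
  apply: cvg_EFin; first exact: nearW.
  apply: (@cvg_comp _ _ _ (fun n : nat => n%:R : R) F _ +oo%R).
    exact: cvgr_idn.
  exact: cumulativey.
exact: (cvg_unique _ h1 h2).
Qed.

HB.instance Definition _ := Measure_isProbability.Build _ _ _ nu nuT.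

Let nu_dom : nu `<< mu.
Proof.
apply/null_content_dominatesP => A mA A0; apply: null_set_integral => //.
exact: measurable_funTS.
Qed.

Let Rint_nu (phi : TR -> R) : bounded_mfun phi ->
  \int[nu]_x phi x = \int[mu]_x (phi x * f x).
Proof.
move=> bphi; have mphi : measurable_fun [set: TR] (EFin \o phi).
  exact/measurable_EFinP/bounded_mfun_meas.
have iphi : nu.-integrable setT (EFin \o phi) by exact: bounded_mfun_integrable.
rewrite /Rintegral; congr fine.
rewrite -(Radon_Nikodym_change_of_variables nu_dom)//=.
rewrite [RHS](_ : _ = \int[mu]_x ((phi x)%:E * (f x)%:E))%E//.
apply: ae_eq_integral => //.
- by apply: emeasurable_funM => //; apply: (measurable_int mu).
- exact: emeasurable_funM.
- apply: ae_eqe_mul2l => /=.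
  rewrite Radon_NikodymE//=.
  case: cid => /= h [h1 h2 h3].
  by apply: integral_ae_eq => //= E _ mE; rewrite -h3.
Qed.

Lemma density_law : exists p : probability R R,
  [/\ forall x, p `]-oo, x]%classic = (F x)%:E, no_atom p &
    forall phi : R -> R, bounded_mfun phi ->
      \int[p]_x phi x = \int[mu]_x (phi x * f x)].
Proof.
(* The identity transports the law from [measurableTypeR R], where Lebesgue measure lives, to the
   measurable structure of [R]. *)
have mid : @measurable_fun _ _ TR R setT idfun by exact:
  (@measurable_id _ _ setT).
pose X : {mfun TR >-> R} := @mfun_Sub _ _ TR R idfun (mem_set mid).
exists [the probability _ _ of distribution nu X]; split.
- by move=> x; case: Ff => _ _ ->.
- move=> x; have /null_content_dominatesP h := nu_dom.
  apply: (h [set x]); first exact: measurable_set1.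
  exact: (lebesgue_measure_set1 x).
- by move=> phi bphi; rewrite Rint_distribution// -Rint_nu//.
Qed.

End density.

Lemma cdf_measurable_real (F : cumulativeBounded (0 : R)
  (1 : R)) : measurable_fun setT F.
Proof. by apply: nondecreasing_measurable => //; exact:
  cumulative_is_nondecreasing. Qed.

Lemma cdf_bounds p (F : R -> R) : (forall x, p `]-oo, x]%classic = (F x)%:E) ->
  forall x, 0 <= F x <= 1.
Proof. by move=> pF x; rewrite -!lee_fin -pF measure_ge0 probability_le1. Qed.

Lemma bounded_mfun_cdf p (F : cumulativeBounded (0 : R) (1 : R)) :
  (forall x, p `]-oo, x]%classic = (F x)%:E) -> bounded_mfun F.
Proof.
move=> pF; split; first exact: cdf_measurable_real.
exists 1 => x; have /andP[? ?] := cdf_bounds pF x.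
by rewrite ger0_norm.
Qed.

Lemma no_atom_itvNyo p x : no_atom p -> p `]-oo, x[%classic = p `]-oo,
  x]%classic.
Proof.
move=> p0; have -> : `]-oo, x]%classic = `]-oo, x[ `|` [set x].
  apply/seteqP; split => y /=; rewrite !in_itv/= le_eqVlt.
    by move=> /orP[/eqP ->|]; [right|left].
  by move=> [->|->]; rewrite ?eqxx ?orbT.
rewrite measureU//; first by rewrite [X in (_ + X)%E]p0 adde0.
by apply/seteqP; split => y //= []; rewrite in_itv/= => + yx; rewrite yx ltxx.
Qed.

Lemma symmetric_law p (F : R -> R) : no_atom p ->
  (forall x, p `]-oo, x]%classic = (F x)%:E) ->
  (forall x, F (- x) = 1 - F x) ->
  forall A : set R, measurable A -> p ((fun x : R => - x) @^-1` A) = p A.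
Proof.
move=> p0 pF Fsym.
have mN : measurable_fun setT (fun x : R => - x) by exact: oppr_measurable.
pose X : {mfun R >-> R} := mfun_Sub (mem_set mN).
apply: (@law_unique [the probability _ _ of distribution p X] p) => x /=.
rewrite /distribution /pushforward.
rewrite [X in p X](_ : _ = ~` `]-oo, (- x)[%classic); last first.
  by apply/seteqP; split => y /=; rewrite !in_itv/= lerNl leNgt => /negP.
rewrite probability_setC// [X in (_ - X)%E]no_atom_itvNyo// !pF Fsym.
by rewrite -EFinB subKr.
Qed.

Lemma Rint_swap d1 d2 (T1 : measurableType d1) (T2 : measurableType d2)
    (P1 : probability T1 R) (P2 : probability T2 R) (f : T1 * T2 ->
      R) : bounded_mfun f ->
  \int[P1]_x \int[P2]_y f (x, y) = \int[P2]_y \int[P1]_x f (x, y).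
Proof.
move=> bf.
have bf1 x : bounded_mfun (fun y => f (x, y)) by apply:
  (bounded_mfun_comp _ bf); exact: pair1_measurable.
have bf2 y : bounded_mfun (fun x => f (x, y)) by apply:
  (bounded_mfun_comp _ bf); exact: pair2_measurable.
have := Fubini (bounded_mfun_integrable (P1 \x P2)%E bf).
rewrite /Rintegral => FE; transitivity (fine (\int[P1]_x \int[P2]_y (f (x,
  y))%:E)%E).
  congr fine; apply: eq_integral => x _; rewrite fineK//.
  by apply: integrable_fin_num => //; exact: bounded_mfun_integrable (bf1 x).
rewrite FE; congr fine; apply: eq_integral => y _; rewrite fineK//.
by apply: integrable_fin_num => //; exact: bounded_mfun_integrable (bf2 y).
Qed.

Lemma Rint_cdf p (x : R) : \int[p]_y \1_`]-oo, x]%classic y = fine (p `]-oo,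
  x]%classic).
Proof. by rewrite Rint_indic. Qed.

(* Fubini applied to the indicators of [y <= x] and of [x <= y] *)
Lemma Rint_cdf_parts p q (Fp Fq : R -> R) : no_atom q ->
  (forall x, p `]-oo, x]%classic = (Fp x)%:E) ->
  (forall x, q `]-oo, x]%classic = (Fq x)%:E) ->
  bounded_mfun Fp -> bounded_mfun Fq ->
  \int[p]_x Fq x + \int[q]_x Fp x = 1.
Proof.
move=> q0 pF qF bFp bFq.
pose f (z : R * R) : R := \1_[set u : R * R | u.1 <= u.2] z.
have mS : measurable [set u : R * R | u.1 <= u.2].
  rewrite -[X in measurable X]setTI.
  exact: (@measurable_fun_ler _ _ _ setT fst snd).
have bf : bounded_mfun f by exact: bounded_mfun_indic.
have bF2 x : bounded_mfun (fun y => f (x, y)) by apply: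
  (bounded_mfun_comp _ bf); exact: pair1_measurable.
have b1 x : bounded_mfun (\1_`]-oo, x]%classic : R ->
  R) by exact: bounded_mfun_indic.
have -> : \int[q]_y Fp y = \int[p]_x \int[q]_y f (x, y).
  rewrite Rint_swap//; apply: eq_Rint => y.
  rewrite -[LHS]/(fine (Fp y)%:E) -pF -Rint_cdf; apply: eq_Rint => x.
  by rewrite /f !indicE; congr ((_ : bool)%:R); apply/idP/idP => /set_mem h;
    apply/mem_set; move: h; rewrite /= in_itv.
have -> : \int[p]_y Fq y = \int[p]_x \int[q]_y (\1_`]-oo, x]%classic y).
  by apply: eq_Rint => x; rewrite Rint_cdf qF.
have [bb _] := Rint_prod p q bf.
rewrite -RintD//; last first.
  rewrite (_ : (fun x => _) = Fq)//.
  by apply/funext => x; rewrite Rint_cdf qF.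
rewrite -[RHS](Rint_cst p); apply: eq_Rint => x.
rewrite -RintD//.
(* The two indicators overlap exactly on the diagonal, which [q] does not charge. *)
have -> : \int[q]_y (\1_`]-oo, x]%classic y + f (x,
  y)) = \int[q]_y (1 + \1_[set x] y).
  apply: eq_Rint => y; rewrite /f !indicE.
  have -> : (y \in `]-oo, x]%classic) = (y <= x).
    by apply/idP/idP => [/set_mem|h]; [|apply/mem_set]; rewrite /= in_itv.
  have -> : ((x, y) \in [set u : R * R | u.1 <= u.2]) = (x <= y).
    by apply/idP/idP => [/set_mem|h]; [|apply/mem_set].
  have -> : (y \in [set x]) = (y == x).
    by apply/idP/eqP => [/set_mem|h]; [|apply/mem_set].
  by case: ltgtP; rewrite ?addr0 ?add0r.
rewrite RintD; [|exact: bounded_mfun_cst|exact: bounded_mfun_indic].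
by rewrite Rint_cst Rint_indic// q0 addr0.
Qed.

End laws_on_R.

(** * Sums weighted by the ranks of the absolute values *)

Section mixture.
Context (R : realType) d1 d2 d (T1 : measurableType d1) (T2 : measurableType d2)
  (Z : measurableType d) (p : probability T1 R) (q : probability T2 R)
  (X : {mfun T1 >-> Z}) (Y : {mfun T2 >-> Z}) (e : R).
Hypothesis e01 : 0 <= e <= 1.

Let e0 : 0 <= e. Proof. by case/andP: e01. Qed.
Let e1 : 0 <= 1 - e. Proof. by case/andP: e01; lra. Qed.

Let mix : set Z -> \bar R := measure_add
  (mscale (NngNum e1) (distribution p X)) (mscale (NngNum e0)
    (distribution q Y)).

HB.instance Definition _ := Measure.on mix.

Let mixT : mix setT = 1%E.
Proof.
rewrite /mix measure_addE.
change ((1 - e)%:E * p (X @^-1` setT) + e%:E * q (Y @^-1` setT) = 1)%E.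
rewrite !preimage_setT !probability_setT.
by rewrite -!EFinM -EFinD; congr EFin; lra.
Qed.

HB.instance Definition _ := Measure_isProbability.Build _ _ _ mix mixT.

Lemma mixture_ex : exists L : probability Z R, forall phi : Z -> R,
  bounded_mfun phi ->
  \int[L]_z phi z = (1 - e) * \int[p]_x phi (X x) + e * \int[q]_x phi (Y x).
Proof.
pose Lm : probability Z R := [the probability _ _ of mix]; exists Lm.
have pos (phi : Z -> R) : bounded_mfun phi -> (forall z, 0 <= phi z) ->
  \int[Lm]_z phi z = (1 - e) * \int[p]_x phi (X x) + e * \int[q]_x phi (Y x).
  move=> bphi phi0; have mphi : measurable_fun setT (EFin \o phi).
    exact/measurable_EFinP/bounded_mfun_meas.
  have phi0' z : (0 <= (phi z)%:E)%E by rewrite lee_fin.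
  rewrite -(Rint_distribution p X bphi) -(Rint_distribution q Y bphi).
  rewrite -[LHS]/(\int[mix]_z phi z) /Rintegral /mix ge0_integral_measure_add//.
  rewrite !ge0_integral_mscale//=.
  have fp : (\int[distribution p X]_x (phi x)%:E)%E \is a fin_num.
    by apply: integrable_fin_num => //; exact: bounded_mfun_integrable.
  have fq : (\int[distribution q Y]_x (phi x)%:E)%E \is a fin_num.
    by apply: integrable_fin_num => //; exact: bounded_mfun_integrable.
  by rewrite fineD ?fin_numM// !fineM.
move=> phi bphi; have [_ [M phiM]] := bphi.
have bM : bounded_mfun (cst M : Z -> R) by exact: bounded_mfun_cst.
have bX : bounded_mfun (fun x => phi (X x)) by apply:
  (bounded_mfun_comp _ bphi).
have bY : bounded_mfun (fun x => phi (Y x)) by apply: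
  (bounded_mfun_comp _ bphi).
(* The nonnegative case, applied to [phi + M], suffices: the weights sum to 1, so the constant
   cancels. *)
have := pos (fun z => phi z + M) (bounded_mfunD bphi bM).
have e1' : \int[Lm]_z (phi z + M) = \int[Lm]_z phi z + M.
  by rewrite RintD ?Rint_cst//; exact: bounded_mfun_cst.
have e2' : \int[p]_z (phi (X z) + M) = \int[p]_z phi (X z) + M.
  by rewrite RintD ?Rint_cst//; exact: bounded_mfun_cst.
have e3' : \int[q]_z (phi (Y z) + M) = \int[q]_z phi (Y z) + M.
  by rewrite RintD ?Rint_cst//; exact: bounded_mfun_cst.
rewrite e1' e2' e3' => h.
have h0 z : 0 <= phi z + M by have := phiM z; rewrite ler_norml => /andP[? _];
  lra.
by have := h h0; lra.
Qed.

End mixture.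

(** * Projection of rank-weighted sums onto sums of independent terms *)

Section hajek.
Context (R : realType) d (Z : measurableType d) (L : probability Z R)
  (v : Z -> R).
Hypothesis mv : measurable_fun setT v.

Definition abs_le_ind (u : Z * Z) : R := (`|v u.2| <= `|v u.1|)%R%:R.

Definition abs_cdf (z : Z) : R := \int[L]_w abs_le_ind (z, w).

Lemma bounded_mfun_abs_le_ind : bounded_mfun abs_le_ind.
Proof.
have mS : measurable [set u : Z * Z | `|v u.2| <= `|v u.1|].
  rewrite -[X in measurable X]setTI.
  apply: (@measurable_fun_ler _ _ _ setT (fun u : Z * Z => `|v u.2|) (fun u =>
    `|v u.1|) _ _ measurableT [set true]) => //.
  - by apply: measurableT_comp => //; exact: (measurableT_comp mv).
  - by apply: measurableT_comp => //; exact: (measurableT_comp mv).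
rewrite (_ : abs_le_ind = \1_[set u : Z * Z | `|v u.2| <= `|v u.1|]);
  first exact: bounded_mfun_indic.
apply/funext => u; rewrite indicE /abs_le_ind; congr ((_ : bool)%:R).
by apply/idP/idP => [h|/set_mem//]; apply/mem_set.
Qed.

Lemma bounded_mfun_abs_cdf : bounded_mfun abs_cdf.
Proof. by have [] := Rint_prod L L bounded_mfun_abs_le_ind. Qed.

Lemma bounded_mfun_abs_le_ind1 z : bounded_mfun (fun w => abs_le_ind (z, w)).
Proof. by apply: (bounded_mfun_comp _ bounded_mfun_abs_le_ind);
  exact: pair1_measurable. Qed.

Lemma abs_cdf_bounds z : 0 <= abs_cdf z <= 1.
Proof.
apply/andP; split; first by apply: Rintegral_ge0 => w _;
  rewrite /abs_le_ind ler0n.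
rewrite -[leRHS](Rint_cst L); apply: le_Rint; [exact:
  bounded_mfun_abs_le_ind1|exact: bounded_mfun_cst|].
by move=> w; rewrite /abs_le_ind lern1; case: (_ <= _).
Qed.

Definition abs_rank n (y : n.-tuple Z) (i : 'I_n) : R :=
  \sum_j (`|v (tnth y j)| <= `|v (tnth y i)|)%R%:R.

Section sample.
Context n (Q : probability (n.-tuple Z) R).
Hypothesis QL : is_product_law L Q.

Lemma tnth_tupd (y : n.-tuple Z) l x i :
  tnth (tupd y l x) i = if i == l then x else tnth y i.
Proof. by rewrite tnth_mktuple. Qed.

Lemma bounded_mfun_tnth i (g : Z -> R) : bounded_mfun g ->
  bounded_mfun (fun y : n.-tuple Z => g (tnth y i)).
Proof. by move=> bg; apply: (bounded_mfun_comp _ bg);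
  exact: measurable_tnth. Qed.

Lemma bounded_mfun_tnth2 i j (g : Z * Z -> R) : bounded_mfun g ->
  bounded_mfun (fun y : n.-tuple Z => g (tnth y i, tnth y j)).
Proof.
move=> bg; apply: (bounded_mfun_comp (h := fun y : n.-tuple Z => (tnth y i,
  tnth y j)) _ bg).
by apply: measurable_fun_pair; exact: measurable_tnth.
Qed.

Lemma bounded_mfun_abs_rank i : bounded_mfun (fun y : n.-tuple Z =>
  abs_rank y i).
Proof. by apply: bounded_mfun_sum => j; exact: (bounded_mfun_tnth2 i j
  bounded_mfun_abs_le_ind). Qed.

Lemma Rint_tnth i (g : Z -> R) : bounded_mfun g ->
  \int[Q]_y g (tnth y i) = \int[L]_z g z.
Proof.
move=> bg; rewrite (resample_Rint QL i) ?bounded_mfun_tnth//;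
  last exact: bounded_mfun_tnth.
rewrite -[RHS](Rint_cst Q); apply: eq_Rint => y; apply: eq_Rint => x.
by rewrite tnth_tupd eqxx.
Qed.

(** A comparison minus its mean given the first argument. Summed over the sample in the second
    argument, it is the error of replacing a rank by [n * abs_cdf]. *)
Let psi (u : Z * Z) := abs_le_ind u - abs_cdf u.1.

Let bpsi : bounded_mfun psi.
Proof.
apply: bounded_mfunB; first exact: bounded_mfun_abs_le_ind.
by apply: (bounded_mfun_comp _ bounded_mfun_abs_cdf); exact: measurable_fst.
Qed.

Let Rint_psi z : \int[L]_w psi (z, w) = 0.
Proof.
rewrite RintB /=; first by rewrite Rint_cst subrr.
- exact: (bounded_mfun_abs_le_ind1 z).
- exact: bounded_mfun_cst.
Qed.

Let psi_norm u : `|psi u| <= 1.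
Proof.
have /andP[h1 h2] := abs_cdf_bounds u.1.
rewrite /psi /abs_le_ind ler_norml.
by case: (`|v u.2| <= `|v u.1|) => /=; apply/andP; split; lra.
Qed.

Section weighted.
Variable a : Z -> R.
Hypothesis ba : bounded_mfun a.
Hypothesis a1 : forall z, `|a z| <= 1.

Let alpha := \int[L]_z `|a z|.
Let m := \int[L]_z (a z * abs_cdf z).

Let bna : bounded_mfun (fun z => `|a z|). Proof. exact: bounded_mfun_norm. Qed.
Let bak : bounded_mfun (fun z => a z * abs_cdf z). Proof. exact: bounded_mfunM
  ba bounded_mfun_abs_cdf. Qed.

(** Of two distinct indices [j] and [l], at least one differs from [i]; integrating out that
    observation alone annihilates its factor [psi]. *)
Let cross i j l : j != l ->
  \int[Q]_y (`|a (tnth y i)| * psi (tnth y i, tnth y j) * psi (tnth y i,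
    tnth y l)) = 0.
Proof.
move=> jl.
have key j' l' : j' != l' -> i != l' ->
    \int[Q]_y (`|a (tnth y i)| * psi (tnth y i, tnth y j') * psi (tnth y i,
      tnth y l')) = 0.
  move=> jl' il'; rewrite (resample_Rint QL l'); last first.
    apply: bounded_mfunM; [apply: bounded_mfunM|];
      [exact: (bounded_mfun_tnth i bna)|exact: (bounded_mfun_tnth2 i j'
      bpsi)|exact: (bounded_mfun_tnth2 i l' bpsi)].
  rewrite -[RHS](Rint_cst Q); apply: eq_Rint => y.
  under eq_Rint do rewrite !tnth_tupd eqxx (negbTE jl') (negbTE il').
  rewrite RintZ ?Rint_psi ?mulr0//.
  by apply: (bounded_mfun_comp _ bpsi); exact: pair1_measurable.
have [il|il] := eqVneq i l; last exact: key.
rewrite -[RHS](key l j); last 2 first.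
- by rewrite eq_sym.
- by rewrite il eq_sym.
by apply: eq_Rint => y; rewrite mulrAC.
Qed.

Let Rint_psi_sqr i : \int[Q]_y (`|a (tnth y i)| * (\sum_j psi (tnth y i,
  tnth y j)) ^+ 2) <= n%:R * alpha.
Proof.
have bt j l : bounded_mfun (fun y : n.-tuple Z => `|a (tnth y i)| * psi
  (tnth y i, tnth y j) * psi (tnth y i, tnth y l)).
  apply: bounded_mfunM; [apply: bounded_mfunM|]; [exact:
    (bounded_mfun_tnth i bna)|exact: (bounded_mfun_tnth2 i j bpsi)|exact:
    (bounded_mfun_tnth2 i l bpsi)].
under eq_Rint => y.
  rewrite expr2 mulr_suml mulr_sumr.
  under eq_bigr => j _ do rewrite mulr_sumr mulr_sumr.
  under eq_bigr => j _ do under eq_bigr => l _ do rewrite mulrA.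
  over.
rewrite Rint_sum => [|j]; last by apply: bounded_mfun_sum => l; exact: bt.
have -> : n%:R * alpha = \sum_(j < n) alpha.
  by rewrite sumr_const card_ord mulr_natl.
apply: ler_sum => j _.
rewrite Rint_sum; last by move=> l; exact: bt.
rewrite (bigD1 j)//= big1 ?addr0; last by move=> l lj; rewrite cross// eq_sym.
rewrite /alpha -(Rint_tnth i bna); apply: le_Rint => //;
  first exact: (bounded_mfun_tnth i bna).
move=> y; rewrite -mulrA ler_piMr// -expr2 -real_normK ?num_real//.
by rewrite exprn_ile1.
Qed.

Let rn := Num.sqrt n%:R : R.

(** The weight stays outside the square: with [s] the inner sum, |a| |s| <= |a| (rn + s^2 / rn) / 2.
    Both halves are then linear in [alpha], which is small when [a] vanishes off the contaminated
    observations. *)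
Let rank_error : (0 < n)%N ->
  \int[Q]_y `|\sum_i a (tnth y i) * (\sum_j psi (tnth y i,
    tnth y j))| <= n%:R * rn * alpha.
Proof.
move=> n0; have r0 : 0 < rn by rewrite sqrtr_gt0 ltr0n.
have rr : n%:R = rn * rn by rewrite -expr2 sqr_sqrtr ?ler0n.
have bs i : bounded_mfun (fun y : n.-tuple Z => \sum_j psi (tnth y i,
  tnth y j)).
  by apply: bounded_mfun_sum => j; exact: (bounded_mfun_tnth2 i j bpsi).
have bai i := bounded_mfun_tnth i ba; have bnai i := bounded_mfun_tnth i bna.
have b2 i : bounded_mfun (fun y : n.-tuple Z => `|a (tnth y i)| * (\sum_j psi
  (tnth y i, tnth y j)) ^+ 2).
  by apply: bounded_mfunM (bnai i) _; apply: bounded_mfunX.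
apply: (@le_trans _ _ (\int[Q]_y \sum_i (rn / 2 * `|a (tnth y i)| +
    (2 * rn)^-1 * (`|a (tnth y i)| * (\sum_j psi (tnth y i, tnth y j)) ^+ 2)))).
  apply: le_Rint.
  - by apply: bounded_mfun_norm; apply: bounded_mfun_sum => i;
    exact: bounded_mfunM (bai i) (bs i).
  - by apply: bounded_mfun_sum => i; apply: bounded_mfunD; apply: bounded_mfunZ.
  move=> y; apply: (le_trans (ler_norm_sum _ _ _)); apply: ler_sum => i _.
  rewrite normrM.
  apply: (@le_trans _ _ (`|a (tnth y i)| * ((rn + (\sum_j psi (tnth y i,
    tnth y j)) ^+ 2 / rn) / 2))).
    by rewrite ler_wpM2l// ler_norm_amgm.
  rewrite le_eqVlt; apply/orP; left; apply/eqP.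
  by move: (`|_|) (\sum_j _) => A B; field; rewrite gt_eqF.
rewrite Rint_sum; last by move=> i; apply: bounded_mfunD; apply: bounded_mfunZ.
apply: (@le_trans _ _ (\sum_(i < n) (rn * alpha))); last first.
  by rewrite sumr_const card_ord -[_ *+ n]mulr_natl mulrA.
apply: ler_sum => i _; rewrite RintD; [|exact: bounded_mfunZ|exact:
  bounded_mfunZ].
rewrite RintZ// RintZ// (Rint_tnth i bna) -/alpha.
apply: (@le_trans _ _ (rn / 2 * alpha + (2 * rn)^-1 * (n%:R * alpha))).
  rewrite lerD2l; apply: ler_wpM2l; last exact: Rint_psi_sqr.
  by rewrite invr_ge0 mulr_ge0 ?ltW.
by rewrite rr le_eqVlt; apply/orP; left; apply/eqP; field; rewrite gt_eqF.
Qed.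

Let kap (y : n.-tuple Z) i := a (tnth y i) * abs_cdf (tnth y i) - m.

Let bkap i : bounded_mfun (fun y => kap y i).
Proof. by apply: bounded_mfunB; [exact: (bounded_mfun_tnth i bak)|exact:
  bounded_mfun_cst]. Qed.

Let cross2 i j : i != j -> \int[Q]_y (kap y i * kap y j) = 0.
Proof.
move=> ij; rewrite (resample_Rint QL j); last exact: bounded_mfunM.
rewrite -[RHS](Rint_cst Q); apply: eq_Rint => y; rewrite /kap.
under eq_Rint do rewrite !tnth_tupd eqxx (negbTE ij).
rewrite RintZ; last by apply: bounded_mfunB => //; exact: bounded_mfun_cst.
by rewrite RintB ?Rint_cst -?/m ?subrr ?mulr0//; exact: bounded_mfun_cst.
Qed.

(** The [kap y i] are centred and uncorrelated, with variance at most [alpha] because (a K)^2 <= |a|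
    for K = [abs_cdf]. The inequality [ler_norm_amgm] is used with [c = rn * eta]. *)
Let projection_error (eta : R) : 0 < eta -> (0 < n)%N ->
  \int[Q]_y `|n%:R * \sum_i kap y i| <= n%:R * rn * (eta / 2 + alpha /
    (2 * eta)).
Proof.
move=> eta0 n0; have r0 : 0 < rn by rewrite sqrtr_gt0 ltr0n.
have rr : n%:R = rn * rn by rewrite -expr2 sqr_sqrtr ?ler0n.
have bS : bounded_mfun (fun y => \sum_i kap y i) by apply: bounded_mfun_sum.
have S2 : \int[Q]_y ((\sum_i kap y i) ^+ 2) <= n%:R * alpha.
  under eq_Rint => y.
    rewrite expr2 mulr_suml; under eq_bigr => i _ do rewrite mulr_sumr.
    over.
  rewrite Rint_sum => [|i]; last by apply: bounded_mfun_sum => j;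
    exact: bounded_mfunM.
  have -> : n%:R * alpha = \sum_(i < n) alpha.
    by rewrite sumr_const card_ord mulr_natl.
  apply: ler_sum => i _.
  rewrite Rint_sum; last by move=> j; exact: bounded_mfunM.
  rewrite (bigD1 i)//= big1 ?addr0; last by move=> j ji;
    rewrite cross2// eq_sym.
  pose g z := a z * abs_cdf z; have bg : bounded_mfun g := bak.
  have bgm : bounded_mfun (fun z => (g z - m) * (g z - m)).
    by apply: bounded_mfunM; apply: bounded_mfunB => //;
      exact: bounded_mfun_cst.
  rewrite (Rint_tnth i bgm).
  have -> : \int[L]_z ((g z - m) * (g z - m)) = \int[L]_z (g z * g z) - m * m.
    rewrite (@eq_Rint _ _ _ L _ (fun z => g z * g z - (2 * m * g z - m * m)));
      last by move=> z; lra.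
    rewrite RintB; [|exact: bounded_mfunM|by apply: bounded_mfunB;
      [exact: bounded_mfunZ|exact: bounded_mfun_cst]].
    rewrite RintB; [|exact: bounded_mfunZ|exact: bounded_mfun_cst].
    by rewrite RintZ// Rint_cst -/m; lra.
  apply: (@le_trans _ _ (\int[L]_z (g z * g z))); first by rewrite gerBl
    -expr2 sqr_ge0.
  apply: le_Rint => //; first exact: bounded_mfunM.
  move=> z; rewrite /g -expr2 -real_normK ?num_real// normrM exprMn expr2.
  have /andP[k0 k1] := abs_cdf_bounds z; rewrite (ger0_norm k0) -mulrA
    ler_piMr//.
  by rewrite mulr_ile1 ?exprn_ge0// exprn_ile1.
apply: (@le_trans _ _ (\int[Q]_y (n%:R * ((rn * eta) / 2) + n%:R / (2 *
  (rn * eta)) * (\sum_i kap y i) ^+ 2))).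
  apply: le_Rint; first by apply: bounded_mfun_norm; exact: bounded_mfunZ.
  - by apply: bounded_mfunD; [exact: bounded_mfun_cst|apply: bounded_mfunZ;
    exact: bounded_mfunX].
  move=> y; rewrite normrM ger0_norm//.
  apply: (@le_trans _ _ (n%:R * ((rn * eta + (\sum_i kap y i) ^+ 2 /
    (rn * eta)) / 2))).
    by rewrite ler_wpM2l// ler_norm_amgm// mulr_gt0.
  rewrite le_eqVlt; apply/orP; left; apply/eqP.
  by move: (\sum_i _) (n%:R : R) => A B; field; rewrite !gt_eqF.
rewrite RintD; [|exact: bounded_mfun_cst|by apply: bounded_mfunZ;
  exact: bounded_mfunX].
rewrite Rint_cst RintZ; last exact: bounded_mfunX.
apply: (@le_trans _ _ (n%:R * ((rn * eta) / 2) + n%:R / (2 * (rn * eta)) *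
  (n%:R * alpha))).
  rewrite lerD2l; apply: ler_wpM2l => //.
  by rewrite divr_ge0 ?mulr_ge0// ltW.
by rewrite rr le_eqVlt; apply/orP; left; apply/eqP; field; rewrite !gt_eqF.
Qed.

(** The deviation is the sum of the rank error and the projection error. Two choices of weights
    matter: all signs, where [alpha <= 1], and the signs of contaminated observations only, where
    [alpha] is at most the contamination level. *)
Lemma hajek_bound (eta : R) : 0 < eta -> (0 < n)%N ->
  \int[Q]_y `|\sum_i a (tnth y i) * abs_rank y i - n%:R ^+ 2 * m| <=
  n%:R * rn * (alpha + eta / 2 + alpha / (2 * eta)).
Proof.
move=> eta0 n0.
have bs i : bounded_mfun (fun y : n.-tuple Z => \sum_j psi (tnth y i,
  tnth y j)).
  by apply: bounded_mfun_sum => j; exact: (bounded_mfun_tnth2 i j bpsi).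
have bai i := bounded_mfun_tnth i ba.
have bA : bounded_mfun (fun y : n.-tuple Z => `|\sum_i a (tnth y i) *
  (\sum_j psi (tnth y i, tnth y j))|).
  by apply: bounded_mfun_norm; apply: bounded_mfun_sum => i;
    exact: bounded_mfunM (bai i) (bs i).
have bB : bounded_mfun (fun y : n.-tuple Z => `|n%:R * \sum_i kap y i|).
  by apply: bounded_mfun_norm; apply: bounded_mfunZ; exact: bounded_mfun_sum.
have := rank_error n0; have := projection_error eta0 n0.
suff : \int[Q]_y `|\sum_i a (tnth y i) * abs_rank y i - n%:R ^+ 2 * m| <=
  \int[Q]_y `|\sum_i a (tnth y i) * (\sum_j psi (tnth y i, tnth y j))| +
  \int[Q]_y `|n%:R * \sum_i kap y i|.
  by move: (\int[Q]_y _) (\int[Q]_y _) (\int[Q]_y _) => A B C;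
    move: (n%:R * rn) => D; lra.
rewrite -RintD//; apply: le_Rint; last 1 first.
- move=> y; apply: le_trans (ler_normD _ _); rewrite le_eqVlt; apply/orP; left.
  apply/eqP; congr `|_|; rewrite /kap mulr_sumr -big_split/=.
  rewrite [RHS](eq_bigr (fun i => a (tnth y i) * abs_rank y i - n%:R * m));
    last first.
    move=> i _.
    have -> : \sum_j psi (tnth y i, tnth y j) =
        abs_rank y i - n%:R * abs_cdf (tnth y i).
      by rewrite /psi sumrB /= sumr_const card_ord -[X in _ - X]mulr_natl.
    by lra.
  by rewrite sumrB sumr_const card_ord -mulr_natl; lra.
- apply: bounded_mfun_norm; apply: bounded_mfunB; last exact: bounded_mfun_cst.
  by apply: bounded_mfun_sum => i; apply: bounded_mfunM (bai i)
    (bounded_mfun_abs_rank i).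
- exact: bounded_mfunD.
Qed.

End weighted.

Hypothesis v_noatom : forall t : R, L [set z | `|v z| = t] = 0%E.

Lemma no_ties_ae : exists N : set (n.-tuple Z), [/\ measurable N, Q N = 0%E &
  forall y, ~ N y -> (forall i, v (tnth y i) != 0) /\
    injective (fun i => `|v (tnth y i)|)].
Proof.
pose A (u : Z * Z) : R := (`|v u.1| == `|v u.2|)%R%:R.
pose A0 (z : Z) : R := (`|v z| == 0)%R%:R.
have mnv : measurable_fun setT (fun z => `|v z|) by exact: measurableT_comp.
have bA : bounded_mfun A.
  have mS : measurable [set u : Z * Z | `|v u.1| == `|v u.2|].
    rewrite -[X in measurable X]setTI.
    apply: (@measurable_fun_eqr _ _ _ setT (fun u : Z * Z =>
      `|v u.1|) (fun u => `|v u.2|) _ _ measurableT [set true]) => //.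
    - by apply: (measurableT_comp mnv); exact: measurable_fst.
    - by apply: (measurableT_comp mnv); exact: measurable_snd.
  rewrite (_ : A = \1_[set u : Z * Z | `|v u.1| == `|v u.2|]);
    first exact: bounded_mfun_indic.
  by apply/funext => u; rewrite indicE /A mem_setE.
have mv0 (t : R) : measurable [set z | `|v z| == t].
  rewrite -[X in measurable X]setTI.
  by apply: (@measurable_fun_eqr _ _ _ setT (fun z =>
    `|v z|) (cst t) _ _ measurableT [set true]).
have v0E (t : R) : \int[L]_z (`|v z| == t)%R%:R = 0 :> R.
  rewrite (_ : (fun z => _) = \1_[set z | `|v z| == t]); last first.
    by apply/funext => u; rewrite indicE mem_setE.
  rewrite Rint_indic// (_ : [set z | `|v z| == t] = [set z | `|v z| =
    t]) ?v_noatom//.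
  by apply/seteqP; split => z /= /eqP.
have bA0 : bounded_mfun A0.
  rewrite (_ : A0 = \1_[set z | `|v z| == 0]); first exact: bounded_mfun_indic.
  by apply/funext => u; rewrite indicE mem_setE.
(* A diagonal entry detects an observation equal to 0, an off-diagonal entry a tie. Every entry has
   mean 0, so their sum reaches 1 with probability 0. *)
pose g i j (y : n.-tuple Z) : R := if i == j then A0 (tnth y i) else A
  (tnth y i, tnth y j).
have bg i j : bounded_mfun (g i j).
  by rewrite /g; case: eqP => _; [exact: (bounded_mfun_tnth i bA0)|exact:
    (bounded_mfun_tnth2 i j bA)].
have g0 i j y : 0 <= g i j y by rewrite /g; case: eqP.
have Ig i j : \int[Q]_y g i j y = 0.
  rewrite /g; have [ij|ij] := eqVneq i j; first by rewrite
    (Rint_tnth i bA0) v0E.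
  rewrite (resample_Rint QL j); last exact: (bounded_mfun_tnth2 i j bA).
  rewrite -[RHS](Rint_cst Q); apply: eq_Rint => y.
  under eq_Rint do rewrite !tnth_tupd eqxx (negbTE ij).
  rewrite -[RHS](v0E `|v (tnth y i)|); apply: eq_Rint => x.
  by rewrite /A eq_sym.
pose S (y : n.-tuple Z) := \sum_i \sum_j g i j y.
have bS : bounded_mfun S by apply: bounded_mfun_sum => i;
  exact: bounded_mfun_sum.
have S0 y : 0 <= S y by apply: sumr_ge0 => i _; exact: sumr_ge0.
have mN : measurable [set y | 1 <= S y].
  rewrite (_ : [set _ | _] = S @^-1` `[1, +oo[); last first.
    by apply/seteqP; split => y /=; rewrite in_itv/= andbT.
  by rewrite -[X in measurable X]setTI; apply: bS.1.
exists [set y | 1 <= S y]; split => //.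
  have := markov_Rint Q ltr01 bS S0.
  rewrite Rint_sum; last by move=> i; exact: bounded_mfun_sum.
  rewrite big1 => [|i _]; last by rewrite Rint_sum ?big1.
  rewrite mul0r => h; apply/eqP; rewrite -fine_eq0 ?fin_num_measure//.
  by rewrite eq_le h fine_ge0.
move=> y /= Sy.
have gle i j : g i j y <= S y.
  rewrite /S (bigD1 i)//= (bigD1 j)//= -addrA lerDl addr_ge0//.
    exact: sumr_ge0.
  by apply: sumr_ge0 => k _; exact: sumr_ge0.
split=> [i|i j /= ij].
  apply/negP => /eqP vi; apply: Sy; apply: le_trans (gle i i).
  by rewrite /g eqxx /A0 vi normr0 eqxx.
apply/eqP/negP => /negP nij; apply: Sy; apply: le_trans (gle i j).
by rewrite /g (negbTE nij) /A /= ij eqxx.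
Qed.

End sample.
End hajek.

(** * The contamination model *)

Lemma no_atom_abs (R : realType) (p : probability R R) (s t : R) : no_atom p ->
  p [set x | `|x + s| = t] = 0%E.
Proof.
move=> p0.
have h : p ([set t - s] `|` [set - t - s]) = 0%E.
  by rewrite (@measureU0 _ _ _ p [set t - s] [set - t - s])//; exact: p0.
apply: (@subset_measure0 _ _ _ p _ ([set t - s] `|` [set - t - s])) => //.
- rewrite (_ : [set x | _] = (fun x => `|x + s|) @^-1` [set t])//.
  rewrite -[X in measurable X]setTI.
  have mn : measurable_fun setT (fun x : R => `|x + s|).
    by apply: measurableT_comp => //; exact: measurable_funD.
  exact: mn.
- exact: measurableU.
- by move=> x /= <-; case: (ger0P (x + s)) => _; [left|right] => /=; lra.
Qed.

Section interval_laws.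
Context (R : realType) (p : probability R R) (F : cumulativeBounded (0 : R)
  (1 : R)).
Hypothesis p0 : no_atom p.
Hypothesis pF : forall x, p `]-oo, x]%classic = (F x)%:E.

Lemma bounded_mfun_shift (f : R -> R) (s : R) : bounded_mfun f ->
  bounded_mfun (fun x : R => f (x + s)).
Proof. by move=> bf; apply: (bounded_mfun_comp _ bf);
  exact: measurable_funD. Qed.

Lemma bounded_mfun_opp (f : R -> R) : bounded_mfun f ->
  bounded_mfun (fun x : R => f (- x)).
Proof. by move=> bf; apply: (bounded_mfun_comp _ bf);
  exact: oppr_measurable. Qed.

Lemma Rint_abs_le (s t : R) : 0 <= t ->
  \int[p]_x (`|x + s| <= t)%R%:R = F (t - s) - F (- t - s).
Proof.
move=> t0.
have -> : F (t - s) = \int[p]_x \1_`]-oo, (t - s)]%classic x.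
  by rewrite Rint_cdf pF.
have -> : F (- t - s) = \int[p]_x \1_`]-oo, (- t - s)[%classic x.
  by rewrite Rint_indic// no_atom_itvNyo// pF.
rewrite -RintB; [|exact: bounded_mfun_indic|exact: bounded_mfun_indic].
apply: eq_Rint => x; rewrite !indicE !mem_setE !in_itv/= ler_norml.
have -> : (x < - t - s) = ~~ (- t <= x + s) by rewrite -ltNge ltrBrDr.
have -> : (x <= t - s) = (x + s <= t) by rewrite lerBrDr.
have [h1|h1] /= := leP (- t) (x + s); first by rewrite subr0.
have -> : (x + s <= t) = true by lra.
by rewrite subrr.
Qed.

End interval_laws.

Section latent_model.
Context (R : realType) (p q : probability R R) (F G : cumulativeBounded
  (0 : R) (1 : R)).
Variables (f g : R -> R) (e mu : R).
Hypothesis p0 : no_atom p.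
Hypothesis q0 : no_atom q.
Hypothesis pF : forall x, p `]-oo, x]%classic = (F x)%:E.
Hypothesis qG : forall x, q `]-oo, x]%classic = (G x)%:E.
Hypothesis pf : forall phi : R -> R, bounded_mfun phi ->
  \int[p]_x phi x = \int[lebesgue_measure]_x (phi x * f x).
Hypothesis qg : forall phi : R -> R, bounded_mfun phi ->
  \int[q]_x phi x = \int[lebesgue_measure]_x (phi x * g x).
Hypothesis Fsym : forall x, F (- x) = 1 - F x.
Hypothesis Gneg : forall x, G x + G (- x) <= 1.
Hypothesis e01 : 0 <= e <= 1.
Hypothesis mu0 : 0 < mu.

(* The flag of a latent observation tells whether it is contaminated. *)
Local Notation Z := (bool * R)%type.

Lemma latent_ex : exists L : probability Z R, forall phi : Z -> R,
  bounded_mfun phi ->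
  \int[L]_z phi z = (1 - e) * \int[p]_x phi (false,
    x) + e * \int[q]_y phi (true, y + mu).
Proof.
have mX : measurable_fun setT (fun x : R => (false, x)).
  exact: measurable_fun_pair.
have mY : measurable_fun setT (fun x : R => (true, x + mu)).
  by apply: measurable_fun_pair => //; exact: measurable_funD.
exact: (@mixture_ex _ _ _ _ _ _ Z p q (mfun_Sub (mem_set mX)) (mfun_Sub
  (mem_set mY)) e e01).
Qed.

Variable L : probability Z R.
Hypothesis LE : forall phi : Z -> R, bounded_mfun phi ->
  \int[L]_z phi z = (1 - e) * \int[p]_x phi (false,
    x) + e * \int[q]_y phi (true, y + mu).

Let v (z : Z) : R := z.2.
Let mv : measurable_fun setT v. Proof. exact: measurable_snd. Qed.
Local Notation H := (contaminated F G e mu).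

Let bF : bounded_mfun F. Proof. exact: (bounded_mfun_cdf pF). Qed.
Let bG : bounded_mfun G. Proof. exact: (bounded_mfun_cdf qG). Qed.
Let bGmu : bounded_mfun (fun x : R => G (x - mu)). Proof. exact:
  bounded_mfun_shift. Qed.
Let bH : bounded_mfun H. Proof. by apply: bounded_mfunD;
  apply: bounded_mfunZ. Qed.

Lemma latent_measure (A : set Z) : measurable A ->
  fine (L A) = (1 - e) * fine (p [set x | A (false, x)]) +
               e * fine (q [set y | A (true, y + mu)]).
Proof.
move=> mA; rewrite -Rint_indic// LE; last exact: bounded_mfun_indic.
have mX : measurable_fun setT (fun x : R => (false, x)).
  exact: measurable_fun_pair.
have mY : measurable_fun setT (fun x : R => (true, x + mu)).
  by apply: measurable_fun_pair => //; exact: measurable_funD.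
rewrite -!Rint_indic//.
- by rewrite -[X in measurable X]setTI; exact: mY.
- by rewrite -[X in measurable X]setTI; exact: mX.
Qed.

Let fineL (A : set Z) : measurable A -> L A = (fine (L A))%:E.
Proof. by move=> mA; rewrite fineK// fin_num_measure. Qed.

Lemma latent_noatom (t : R) : L [set z | `|v z| = t] = 0%E.
Proof.
have mn : measurable_fun setT (fun z : Z => `|v z|) by exact: measurableT_comp.
have mA : measurable [set z | `|v z| = t].
  by rewrite -[X in measurable X]setTI; exact: (mn measurableT [set t]).
rewrite fineL// latent_measure//= no_atom_abs///=.
have -> : [set x | `|v (false, x)| = t] = [set x | `|x + 0| = t].
  by apply/seteqP; split => x /=; rewrite addr0.
by rewrite no_atom_abs///= !mulr0 addr0.
Qed.

Lemma latent_cdf (x : R) : L (v @^-1` `]-oo, x]) = (H x)%:E.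
Proof.
have mA : measurable (v @^-1` `]-oo, x]).
  by rewrite -[X in measurable X]setTI; exact: mv.
rewrite fineL// latent_measure//; congr EFin; rewrite /contaminated.
congr (_ * _ + _ * _); first by rewrite -[RHS]/(fine (F x)%:E) -pF.
rewrite -[RHS]/(fine (G (x - mu))%:E) -qG; congr (fine (q _)).
by apply/seteqP; split => y /=; rewrite !in_itv/= lerBrDr.
Qed.

(** Contaminated observations are left alone, since symmetry is assumed of [F] and not of [G]. *)
Definition sflip (s : bool) (z : Z) : Z := (z.1, if z.1 then z.2 else if s
  then - z.2 else z.2).

Lemma measurable_sflip s : measurable_fun setT (sflip s).
Proof.
apply: measurable_fun_pair; first exact: measurable_fst.
apply: measurable_fun_ifT; [exact: measurable_fst|exact: measurable_snd|].
case: s; last exact: measurable_snd.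
by apply: measurable_funN; exact: measurable_snd.
Qed.

Lemma latent_sflip s (B : set Z) : measurable B -> L (sflip s @^-1` B) = L B.
Proof.
move=> mB; have mA : measurable (sflip s @^-1` B).
  by rewrite -[X in measurable X]setTI; exact: measurable_sflip.
rewrite fineL// latent_measure// [RHS]fineL// [in RHS]latent_measure//.
congr (_ * _ + _ * _)%:E.
case: s mA => mA; last first.
  by congr (fine (p _)); apply/seteqP; split => x /=.
have mC : measurable ((pair false @^-1` B) : set R).
  by rewrite -[X in measurable X]setTI; apply: pair1_measurable.
by rewrite -[in RHS](symmetric_law p0 pF Fsym mC).
Qed.

Lemma latent_abs_cdf z : abs_cdf L v z = H `|v z| - H (- `|v z|).
Proof.
rewrite /abs_cdf LE; last exact: bounded_mfun_abs_le_ind1.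
rewrite /abs_le_ind /=.
rewrite (Rint_abs_le q0 qG)//.
rewrite (@eq_Rint _ _ _ p _ (fun x => (`|x + 0| <= `|v z|)%R%:R)); last first.
  by move=> x; rewrite addr0.
by rewrite (Rint_abs_le p0 pF)// !subr0 /contaminated; lra.
Qed.

(** The projected summand is an odd function of the observation, which reduces its mean to integrals
    of [F] and [G]. *)
Lemma sg_latent_abs_cdf z : Num.sg (v z) * abs_cdf L v z = H (v z) - H (- v z).
Proof.
rewrite latent_abs_cdf; have [h|h|h] := ltrgt0P (v z).
- by rewrite gtr0_sg// mul1r.
- by rewrite ltr0_sg// mulN1r opprK opprB.
- by rewrite h sgr0 mul0r oppr0 subrr.
Qed.

Let cst1 : bounded_mfun (cst 1 : R -> R). Proof. exact: bounded_mfun_cst. Qed.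

Let Rint_symF (phi : R -> R) : bounded_mfun phi ->
  \int[p]_x phi (- x) = \int[p]_x phi x.
Proof.
move=> bphi; have mN : measurable_fun setT (fun x : R =>
  - x) by exact: oppr_measurable.
pose X : {mfun R >-> R} := mfun_Sub (mem_set mN).
rewrite -(Rint_distribution p X bphi); apply: Rint_eq_measure => A mA.
exact: (symmetric_law p0 pF Fsym).
Qed.

Lemma zetaE : zeta G f mu = 2^-1 - \int[p]_x G (x - mu).
Proof. by rewrite /zeta pf. Qed.

Let bG2 : bounded_mfun (fun x : R => G (- x - 2 * mu)).
Proof. exact: (bounded_mfun_opp (bounded_mfun_shift (- (2 * mu)) bG)). Qed.

Lemma lambdaE : lambda G g mu = 2^-1 - \int[q]_x G (- x - 2 * mu).
Proof. by rewrite /lambda qg. Qed.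

Let Gmono x y : x <= y -> G x <= G y.
Proof. exact: cumulative_is_nondecreasing. Qed.

(** Symmetrize in [x]: as [mu > 0], G(x - mu) + G(-x - mu) <= G(x) + G(-x) <= 1, and both terms on
    the left have the same mean under the symmetric [p]. *)
Lemma zeta_ge0 : 0 <= zeta G f mu.
Proof.
rewrite zetaE subr_ge0.
have bGN : bounded_mfun (fun x : R => G (- x - mu)) by exact:
  (bounded_mfun_opp bGmu).
have : \int[p]_x (G (x - mu) + G (- x - mu)) <= 1.
  rewrite -[leRHS](Rint_cst p); apply: le_Rint => //;
    first exact: bounded_mfunD.
  move=> x; apply: le_trans (Gneg x).
  by apply: lerD; apply: Gmono; move: mu0; lra.
by rewrite RintD// (Rint_symF bGmu); lra.
Qed.

Let Rint_GG : \int[q]_x G x = 2^-1.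
Proof. by have := Rint_cdf_parts q0 qG qG bG bG; lra. Qed.

(** Pointwise, G(-x - 2 mu) <= G(-x) <= 1 - G(x), and the right side has mean [1 / 2] under [q]. *)
Lemma lambda_ge0 : 0 <= lambda G g mu.
Proof.
rewrite lambdaE subr_ge0.
have : \int[q]_x G (- x - 2 * mu) <= \int[q]_x (1 - G x).
  apply: le_Rint => //; first exact: bounded_mfunB.
  move=> x; have := Gneg x.
  have : G (- x - 2 * mu) <= G (- x) by apply: Gmono; move: mu0; lra.
  lra.
by rewrite RintB// Rint_cst Rint_GG; lra.
Qed.

(** Integration by parts between [F] and the law of a contaminated observation, whose distribution
    function is G(x - mu). *)
Let Rint_qF : \int[q]_y F (y + mu) = 2^-1 + zeta G f mu.
Proof.
have mS : measurable_fun setT (fun y : R => y + mu) by exact: measurable_funD.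
pose X : {mfun R >-> R} := mfun_Sub (mem_set mS).
pose q' : probability R R := [the probability _ _ of distribution q X].
have q'0 : no_atom q'.
  move=> x; rewrite /q' /= /distribution /pushforward /=.
  rewrite (_ : _ @^-1` _ = [set x - mu]) ?q0//.
  by apply/seteqP; split => y /=; [move=> <-|move=> ->]; rewrite ?addrK ?subrK.
have q'G x : q' `]-oo, x]%classic = (G (x - mu))%:E.
  rewrite /q' /= /distribution /pushforward -qG /=; congr (q _).
  by apply/seteqP; split => y /=; rewrite !in_itv/= lerBrDr.
have := Rint_cdf_parts q'0 pF q'G bF bGmu.
by rewrite (Rint_distribution q X bF) zetaE /=; lra.
Qed.

Definition signed_mean : R := 2 * e * (1 - e) * zeta G f mu +
  e ^+ 2 * lambda G g mu.

Lemma bounded_mfun_sgr : bounded_mfun (@Num.sg R).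
Proof.
split; last by exists 1 => x; rewrite normr_sg lern1; case: (x != 0).
rewrite (_ : @Num.sg R = fun x => \1_`]0, +oo[%classic x - \1_`]-oo,
  0[%classic x).
  by apply: measurable_funB; exact: measurable_indic.
apply/funext => x; rewrite !indicE !mem_setE !in_itv/= andbT.
have [h|h|->] := ltrgt0P x.
- by rewrite gtr0_sg// subr0.
- by rewrite ltr0_sg// sub0r.
- by rewrite sgr0 subrr.
Qed.

Lemma bounded_mfun_sg_latent : bounded_mfun (fun z : Z => Num.sg (v z)).
Proof. by apply: (bounded_mfun_comp _ bounded_mfun_sgr). Qed.

Definition contam_sg (z : Z) : R := z.1%:R * Num.sg z.2.

Lemma bounded_mfun_contam : bounded_mfun (fun z : Z => z.1%:R : R).
Proof.
split; last by exists 1 => -[[] x] /=; rewrite ?normr1 ?normr0.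
by apply: (measurableT_comp (f := fun b : bool => b%:R : R)) => //.
Qed.

Lemma bounded_mfun_contam_sg : bounded_mfun contam_sg.
Proof. by apply: bounded_mfunM; [exact: bounded_mfun_contam|exact:
  bounded_mfun_sg_latent]. Qed.

Let bHN : bounded_mfun (fun x : R => H x - H (- x)).
Proof. by apply: bounded_mfunB => //; exact: bounded_mfun_opp. Qed.

(** At a contaminated value y + mu, the odd function equals (1 - e) (2 F(y + mu) - 1) + e (G(y) -
    G(-y - 2 mu)). The two brackets have means [2 * zeta] and [lambda] under [q], and contamination
    itself contributes a factor [e]. *)
Lemma Rint_contam_sg : \int[L]_z (contam_sg z * abs_cdf L v z) = signed_mean.
Proof.
rewrite (@eq_Rint _ _ _ L _ (fun z => z.1%:R * (H (v z) - H (- v z))));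
  last first.
  by move=> z; rewrite /contam_sg -mulrA sg_latent_abs_cdf.
rewrite LE; last first.
  by apply: bounded_mfunM; [exact: bounded_mfun_contam|exact:
    (bounded_mfun_comp mv bHN)].
rewrite /= (@eq_Rint _ _ _ p _ (fun=> 0)); last by move=> x; rewrite mul0r.
rewrite Rint_cst mulr0 add0r.
have bFmu : bounded_mfun (fun y : R => F (y + mu)) by exact: bounded_mfun_shift.
rewrite (@eq_Rint _ _ _ q _ (fun y => (1 - e) * (2 * F (y + mu) - 1) +
    e * (G y - G (- y - 2 * mu)))); last first.
  move=> y; rewrite mul1r /contaminated /v /= Fsym addrK.
  have -> : - (y + mu) - mu = - y - 2 * mu by lra.
  by lra.
have b1 : bounded_mfun (fun y : R => 2 * F (y + mu) - 1) by apply: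
  bounded_mfunB => //; exact: bounded_mfunZ.
have b2 : bounded_mfun (fun y : R => G y - G (- y - 2 * mu)) by apply:
  bounded_mfunB.
rewrite RintD; [|exact: bounded_mfunZ|exact: bounded_mfunZ].
rewrite !RintZ// RintB//; last exact: bounded_mfunZ.
rewrite RintZ// RintB// Rint_cst Rint_GG Rint_qF.
have -> : \int[q]_x G (- x - 2 * mu) = 2^-1 - lambda G g mu by rewrite
  lambdaE; lra.
by rewrite /signed_mean; lra.
Qed.

(** Uncontaminated observations add nothing: their law is symmetric and the integrand is odd. *)
Lemma Rint_sg : \int[L]_z (Num.sg (v z) * abs_cdf L v z) = signed_mean.
Proof.
rewrite -Rint_contam_sg (@eq_Rint _ _ _ L _ (fun z => H (v z) - H (- v z)));
  last first.
  by move=> z; exact: sg_latent_abs_cdf.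
rewrite [RHS](@eq_Rint _ _ _ L _ (fun z => z.1%:R * (H (v z) - H (- v z))));
  last first.
  by move=> z; rewrite /contam_sg -mulrA sg_latent_abs_cdf.
rewrite !LE; last 2 first.
- by apply: bounded_mfunM; [exact: bounded_mfun_contam|exact:
  (bounded_mfun_comp mv bHN)].
- exact: (bounded_mfun_comp mv bHN).
congr (_ * _ + _ * _); last by apply: eq_Rint => y; rewrite mul1r.
rewrite [RHS](@eq_Rint _ _ _ p _ (fun=> 0)); last by move=> x; rewrite mul0r.
rewrite Rint_cst /= RintB//; last exact: bounded_mfun_opp.
by rewrite (Rint_symF bH) subrr.
Qed.

Lemma Rint_contam : \int[L]_z z.1%:R = e.
Proof.
rewrite LE; last exact: bounded_mfun_contam.
by rewrite /= !Rint_cst mulr0 add0r mulr1.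
Qed.

Lemma sgr_norm_le1 (x : R) : `|Num.sg x| <= 1.
Proof. by rewrite normr_sg lern1; case: (x != 0). Qed.

Lemma Rint_norm_contam_sg : \int[L]_z `|contam_sg z| <= e.
Proof.
rewrite -[leRHS]Rint_contam; apply: le_Rint.
- by apply: bounded_mfun_norm; exact: bounded_mfun_contam_sg.
- exact: bounded_mfun_contam.
by move=> z; rewrite /contam_sg normrM ger0_norm// ler_piMr// sgr_norm_le1.
Qed.

End latent_model.

Definition latent_rank (R : realType) n (y : n.-tuple (bool * R)) : R :=
  signed_rank (fun i => (tnth y i).2).

Lemma sgr_sign (R : realType) (x : R) : x != 0 -> Num.sg x = (-1) ^+ (x < 0)%R.
Proof.
by have [h|h|->] := ltrgt0P x; rewrite ?eqxx// => _;
  [rewrite gtr0_sg|rewrite ltr0_sg].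
Qed.

Lemma sign_avg_inj (R : rcfType) (I : finType) (r : {ffun I -> bool} ->
  {ffun I -> bool})
    (phi : {ffun I -> bool} -> R) :
  injective r -> sign_avg (fun s => phi (r s)) = sign_avg phi.
Proof. by move=> r_inj; rewrite /sign_avg [in RHS](reindex_inj r_inj). Qed.

Section flip_signs.
Context (R : realType) (n : nat) (y : n.+1.-tuple (bool * R)).
Local Notation N := n.+1.
Let x i := (tnth y i).2.
Hypothesis x0 : forall i, x i != 0.
Hypothesis x_inj : injective (fun i => `|x i|).

(** Flips preserve absolute values, hence ranks. [U] collects the ranks of the uncontaminated
    observations, [t] records the original signs, and [r] carries a pattern of flips of observations
    to signs of ranks; its injectivity keeps fair signs fair. *)
Lemma latent_rank_sflip : exists U : {set 'I_N}, exists t : {ffun 'I_N -> bool},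
  exists r : {ffun 'I_N -> bool} -> {ffun 'I_N -> bool},
  [/\ injective r,
    forall s : {ffun 'I_N -> bool}, latent_rank [tuple sflip (s i)
      (tnth y i) | i < N] =
      rsum R (~: U) t + rsum R U (r s),
    #|~: U|%:R = \sum_i (tnth y i).1%:R :> R &
    rsum R (~: U) t =
      \sum_i contam_sg (tnth y i) * abs_rank (fun z : bool * R => z.2) y i].
Proof.
have [sigma sigma_inj sigmaE] := abs_rank_perm x_inj.
pose rho := invF sigma_inj.
have rhoK k : sigma (rho k) = k by exact: f_invF.
have rho_inj : injective rho by exact: (can_inj rhoK).
pose neg i := (x i < 0)%R.
pose U : {set 'I_N} := [set k | ~~ (tnth y (rho k)).1]%SET.
exists U, [ffun k => neg (rho k)], (fun s : {ffun 'I_N ->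
  bool} => [ffun k => s (rho k) (+) neg (rho k)]).
split.
- move=> s s' ss'; apply/ffunP => i.
  have /ffunP /(_ (sigma i)) := ss'; rewrite !ffunE.
  by rewrite /rho invF_f => /addIb.
- move=> s.
  pose x' i := (sflip (s i) (tnth y i)).2.
  have x'abs i : `|x' i| = `|x i|.
    by rewrite /x' /sflip /=; case: ifP => // _; case: (s i); rewrite ?normrN.
  have x'_inj : injective (fun i => `|x' i|).
    by move=> i j; rewrite !x'abs; exact: x_inj.
  have -> : latent_rank [tuple sflip (s i) (tnth y i) | i < N] = signed_rank x'.
    by congr signed_rank; apply/funext => i; rewrite tnth_mktuple.
  rewrite signed_rank_no_ties// (reindex_inj rho_inj)/=.
  rewrite (eq_bigr (fun k : 'I_N => k.+1%:R * (-1) ^+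
    (if (tnth y (rho k)).1 then neg (rho k) else s (rho k) (+) neg
      (rho k)) : R)); last first.
    move=> k _; congr (_ * _).
      under eq_bigr do rewrite !x'abs.
      by rewrite sigmaE rhoK.
    rewrite /x' /sflip /=; case: ifP => _; first by rewrite sgr_sign// x0.
    case: (s (rho k)) => /=; last by rewrite sgr_sign// x0.
    rewrite sgrN sgr_sign; last exact: x0.
    by rewrite /neg; case: (_ < 0) => /=; rewrite ?expr1 ?expr0 ?opprK.
  rewrite (bigID (fun k => k \in U))/= addrC; congr (_ + _).
    apply: eq_big => k; first by rewrite finset.in_setC.
    by rewrite inE negbK => yk; rewrite /sign_of ffunE yk.
  apply: eq_bigr => k; rewrite inE => /negbTE yk.
  by rewrite /sign_of ffunE yk.
- rewrite -sum1_card natr_sum big_mkcond/= [RHS](reindex_inj rho_inj)/=.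
  by apply: eq_bigr => k _; rewrite !inE negbK; case: (tnth y (rho k)).1.
- rewrite /rsum big_mkcond/= [RHS](reindex_inj rho_inj)/=.
  apply: eq_bigr => k _; rewrite !inE negbK /contam_sg.
  case: (tnth y (rho k)).1; last by rewrite !mul0r.
  rewrite mul1r mulrC /abs_rank sigmaE rhoK sgr_sign; last exact: x0.
  by rewrite /sign_of ffunE.
Qed.

End flip_signs.

(** * Reduction to the latent sample *)

Section transfer.
Context (R : realType).
Local Notation Z := (bool * R)%type.

Lemma measurable_signed_rank_tuple n :
  measurable_fun setT (fun x : n.-tuple R => signed_rank (tnth x)).
Proof.
pose X (i : 'I_n) : {mfun n.-tuple R >-> R} := mfun_Sub (mem_set
  (measurable_tnth i)).
exact: (measurable_signed_rank_stat X).
Qed.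

Lemma measurable_values n :
  measurable_fun setT (fun y : n.-tuple Z => [tuple (tnth y i).2 | i < n]).
Proof.
apply/measurable_fun_tnthP => i.
rewrite (_ : _ \o _ = snd \o (fun y : n.-tuple Z => tnth y i)); last first.
  by apply/funext => p /=; rewrite tnth_mktuple.
by apply: measurableT_comp; [exact: measurable_snd|exact: measurable_tnth].
Qed.

Lemma latent_rankE n (y : n.-tuple Z) :
  latent_rank y = signed_rank (tnth [tuple (tnth y i).2 | i < n]).
Proof. by congr signed_rank; apply/funext => i; rewrite tnth_mktuple. Qed.

Lemma measurable_latent_rank n : measurable_fun setT (@latent_rank R n).
Proof.
rewrite (_ : @latent_rank R n = (fun x : n.-tuple R => signed_rank (tnth x)) \o
   (fun y : n.-tuple Z => [tuple (tnth y i).2 | i < n])).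
  exact: (measurableT_comp (@measurable_signed_rank_tuple n)
    (@measurable_values n)).
by apply/funext => y; exact: latent_rankE.
Qed.

(** Independence and equal marginals give the observations and the latent values the same joint law
    on boxes, hence everywhere. *)
Lemma signed_rank_stat_law d (T : measurableType d) (P : probability T R) n
    (X : 'I_n -> {mfun T >-> R}) (H : R -> R)
    (L : probability Z R) (Q : probability (n.-tuple Z) R) :
  iid P X H -> (forall x, L (snd @^-1` `]-oo, x]) = (H x)%:E) ->
  is_product_law L Q ->
  forall A, measurable A ->
    distribution P (signed_rank_stat X) A = Q (@latent_rank R n @^-1` A).
Proof.
move=> [Xind Xcdf] LH QL A mA.
have mX : measurable_fun setT (fun w => [tuple X i w | i < n]).
  apply/measurable_fun_tnthP => i.
  rewrite (_ : _ \o _ = X i) //.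
  by apply/funext => p /=; rewrite tnth_mktuple.
pose tX : {mfun T >-> n.-tuple R} := mfun_Sub (mem_set mX).
pose tY : {mfun n.-tuple Z >-> n.-tuple R} := mfun_Sub (mem_set
  (@measurable_values n)).
have mS : measurable ((fun x : n.-tuple R => signed_rank (tnth x)) @^-1` A).
  by rewrite -[X in measurable X]setTI; exact: measurable_signed_rank_tuple.
have law i (B : set R) : measurable B -> P (X i @^-1` B) = L (snd @^-1` B).
  move=> mB; pose V : {mfun Z >-> R} := mfun_Sub (mem_set
    (@measurable_snd _ _ bool R)).
  apply: (@law_unique R [the probability _ _ of distribution P (X i)]
    [the probability _ _ of distribution L V]) => // x.
  by rewrite [LHS]Xcdf -LH.
have key := @box_unique _ R R n [the probability _ _ of distribution P tX]
  [the probability _ _ of distribution Q tY].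
transitivity (distribution P tX ((fun x : n.-tuple R =>
  signed_rank (tnth x)) @^-1` A)).
  rewrite /distribution /pushforward; congr (P _).
  have E w : signed_rank_stat X w = signed_rank (tnth (tX w)).
    rewrite /signed_rank_stat; congr signed_rank.
    by apply/funext => i; rewrite /= tnth_mktuple.
  apply/seteqP; split => w.
    by change (A (signed_rank_stat X w) -> A (signed_rank (tnth (tX w))));
      rewrite E.
  by change (A (signed_rank (tnth (tX w))) -> A (signed_rank_stat X w));
    rewrite E.
rewrite [LHS]key//; last first.
  move=> B mB /=; rewrite /distribution /pushforward.
  rewrite [X in _ = Q X](_ : _ = box (fun i => snd @^-1` B i)); last first.
    by apply/seteqP; split => y /= h i; have := h i; rewrite tnth_mktuple.
  rewrite [RHS]QL; last first.
    by move=> i; rewrite -[X in measurable X]setTI; exact: measurable_snd.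
  have := Xind [set: 'I_n]%SET B mB.
  rewrite (_ : \bigcap_(i in _) _ = tX @^-1` box B); last first.
    apply/seteqP; split => w /= h i; first by rewrite tnth_mktuple; apply: h;
      rewrite /= inE.
    by have := h i; rewrite tnth_mktuple.
  move=> ->; rewrite big_mkcond/=; apply: eq_bigr => i _.
  by rewrite inE law.
rewrite /distribution /pushforward; congr (Q _).
by apply/seteqP; split => y /=; rewrite latent_rankE.
Qed.

End transfer.

(** * Concentration and approximate fairness on the latent sample *)

Section latent_sample.
Context (R : realType).
Local Notation Z := (bool * R)%type.
Let v (z : Z) : R := z.2.
Let mv : measurable_fun setT v. Proof. exact: measurable_snd. Qed.
Context (n : nat) (L : probability Z R) (Q : probability (n.+1.-tuple Z) R)
  (e m : R).
Local Notation N := n.+1.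
Hypothesis QL : is_product_law L Q.
Hypothesis L_noatom : forall t : R, L [set z | `|v z| = t] = 0%E.
Hypothesis L_sflip : forall s B, measurable B -> L (sflip s @^-1` B) = L B.
Hypothesis L_contam : \int[L]_z z.1%:R = e.
Hypothesis L_contam_sg : \int[L]_z `|contam_sg z| <= e.
Hypothesis m_contam : \int[L]_z (contam_sg z * abs_cdf L v z) = m.
Hypothesis m_sg : \int[L]_z (Num.sg (v z) * abs_cdf L v z) = m.
Hypothesis m_ge0 : 0 <= m.

Let r : R := Num.sqrt N%:R.
Let r0 : 0 < r. Proof. by rewrite sqrtr_gt0 ltr0n. Qed.
Let rr : N%:R = r * r. Proof. by rewrite -expr2 sqr_sqrtr ?ler0n. Qed.

(** The projection bound with [eta = 1] gives mean deviation at most [2 * N * sqrt N]; Markov's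
    inequality does the rest. The scale [k] is separate from [m] so that the null, where [m] is 0,
    can be measured on the scale of the alternative. *)
Lemma latent_rank_deviation (A : set R) (k : R) : measurable A ->
  (forall x, A x -> N%:R ^+ 2 * k / 2 <= `|x - N%:R ^+ 2 * m|) ->
  0 < k ->
  fine (Q (@latent_rank R N @^-1` A)) <= 4 / (r * k).
Proof.
move=> mA Adev k0.
have [S [mS S0 Snot]] := no_ties_ae mv QL L_noatom.
have sg1 (z : Z) : `|Num.sg (v z)| <= 1 by exact: sgr_norm_le1.
have bsg : bounded_mfun (fun z : Z => Num.sg (v z)) by exact:
  bounded_mfun_sg_latent.
have := hajek_bound mv QL bsg sg1 ltr01 (ltn0Sn n).
rewrite m_sg -/r.
set alpha := \int[L]_z `|_|; have a1 : alpha <= 1.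
  rewrite -[leRHS](Rint_cst L); apply: le_Rint => //;
    last exact: bounded_mfun_cst.
  exact: bounded_mfun_norm.
set I := \int[Q]_y _ => hI.
have {hI} : I <= 2 * (r * r * r).
  apply: (le_trans hI); rewrite rr [leRHS]mulrC ler_pM2l ?mulr_gt0//.
  by move: a1; lra.
have bI : bounded_mfun (fun y : N.-tuple Z => `|\sum_i Num.sg (v
  (tnth y i)) * abs_rank v y i - N%:R ^+ 2 * m|).
  apply: bounded_mfun_norm; apply: bounded_mfunB; last exact: bounded_mfun_cst.
  apply: bounded_mfun_sum => i; apply: bounded_mfunM;
    [exact: (bounded_mfun_tnth i bsg)|exact: bounded_mfun_abs_rank].
have c0 : 0 < N%:R ^+ 2 * k / 2 by rewrite divr_gt0 ?mulr_gt0 ?exprn_gt0 ?ltr0n.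
have mB : measurable (@latent_rank R N @^-1` A).
  by rewrite -[X in measurable X]setTI; exact: measurable_latent_rank.
have := markov_Rint Q c0 bI (fun y => normr_ge0 _).
set B := [set x | _ <= _].
have mBB : measurable B.
  rewrite (_ : B = (fun y : N.-tuple Z => `|\sum_i Num.sg (v
    (tnth y i)) * abs_rank v y i - N%:R ^+ 2 * m|) @^-1` `[N%:R ^+ 2 * k / 2,
    +oo[); last first.
    by apply/seteqP; split => x /=; rewrite in_itv/= andbT.
  by rewrite -[X in measurable X]setTI; apply: bI.1.
move=> hB hI.
have : fine (Q (@latent_rank R N @^-1` A)) <= fine (Q B).
  rewrite -!Rint_indic//; apply: (le_Rint_ae mS S0);
    [exact: bounded_mfun_indic|exact: bounded_mfun_indic|].
  move=> y /Snot[y0 yinj]; rewrite !indicE ler_nat.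
  case: (boolP (y \in _)) => // /set_mem /= Ay; rewrite mem_set// /B /=.
  have := Adev _ Ay; rewrite /latent_rank signed_rank_no_ties//.
  by under eq_bigr do rewrite mulrC.
move=> h; apply: (le_trans h); apply: (le_trans hB).
rewrite ler_pdivrMr//.
apply: (le_trans hI); rewrite rr le_eqVlt; apply/orP; left; apply/eqP.
by field; rewrite !gt_eqF.
Qed.

Definition fair_prob (A : set R) : R := sign_avg (fun s =>
  \1_A (rsum R [set: 'I_N]%SET s) : R).

Lemma latent_rank_fair (A : set R) (eta : R) : measurable A -> (8 <= N)%N ->
  0 < eta ->
  `|fine (Q (@latent_rank R N @^-1` A)) - fair_prob A| <=
  44 * e + 9 / r + 36 * (r * m) + 36 * eta + 36 * (e / eta).
Proof.
move=> mA N8 eta0.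
have [S [mS S0 Snot]] := no_ties_ae mv QL L_noatom.
pose W := @latent_rank R N.
have mW : measurable (W @^-1` A).
  by rewrite -[X in measurable X]setTI; exact: measurable_latent_rank.
have bW : bounded_mfun (\1_(W @^-1` A) : _ -> R) by exact: bounded_mfun_indic.
pose Th (s : {ffun 'I_N -> bool}) (y : N.-tuple Z) : N.-tuple Z :=
  [tuple sflip (s i) (tnth y i) | i < N].
have mTh s : measurable_fun setT (Th s).
  apply/measurable_fun_tnthP => i.
  rewrite (_ : _ \o _ = sflip (s i) \o (fun y : N.-tuple Z => tnth y i));
    last first.
    by apply/funext => p /=; rewrite tnth_mktuple.
  by apply: measurableT_comp; [exact: measurable_sflip|exact: measurable_tnth].
have bTh s : bounded_mfun (fun y => \1_(W @^-1` A) (Th s y) : R) by exact: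
  (bounded_mfun_comp (mTh s) bW).
(* Each pattern of flips preserves the law of the latent sample, so the average over all patterns
   may be placed under the integral. *)
have IE : fine (Q (W @^-1` A)) = \int[Q]_y sign_avg (fun s =>
  \1_(W @^-1` A) (Th s y) : R).
  rewrite -Rint_indic//.
  under [RHS]eq_Rint do rewrite /sign_avg mulrC.
  rewrite RintZ; last by apply: bounded_mfun_sum.
  rewrite Rint_sum//.
  rewrite (eq_bigr (fun=> \int[Q]_y \1_(W @^-1` A) y)); last first.
    move=> s _; rewrite [RHS](product_law_map (theta :=
      fun i => sflip (s i)) QL)//.
    - by move=> i; exact: measurable_sflip.
    - by move=> i B mB; exact: L_sflip.
  by rewrite mulrC -[LHS](@sign_avg_cst R 'I_N).
have bs : bounded_mfun (fun y => sign_avg (fun s =>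
  \1_(W @^-1` A) (Th s y) : R)).
  rewrite /sign_avg; apply: bounded_mfunM; last exact: bounded_mfun_cst.
  exact: bounded_mfun_sum.
rewrite -/W IE -(Rint_cst Q (fair_prob A)) -RintB//;
  last exact: bounded_mfun_cst.
pose D (y : N.-tuple Z) : R := \sum_i contam_sg (tnth y i) * abs_rank v y i.
pose u (y : N.-tuple Z) : R := \sum_i (tnth y i).1%:R.
have bcs : bounded_mfun (@contam_sg R) by exact: bounded_mfun_contam_sg.
have bD : bounded_mfun D.
  by apply: bounded_mfun_sum => i; apply: bounded_mfunM;
    [exact: (bounded_mfun_tnth i bcs)|exact: bounded_mfun_abs_rank].
have bc : bounded_mfun (fun z : Z => z.1%:R : R) by exact: bounded_mfun_contam.
have bu : bounded_mfun u by apply: bounded_mfun_sum => i;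
  exact: (bounded_mfun_tnth i bc).
have bdiff : bounded_mfun (fun y => sign_avg (fun s =>
  \1_(W @^-1` A) (Th s y) : R) - fair_prob A).
  by apply: bounded_mfunB => //; exact: bounded_mfun_cst.
(* The bound of [sign_avg_rsum_smooth], sorted by its dependence on the sample: through the number
   [u] of contaminated observations, and through their signed rank sum [D]. *)
pose k1 : R := (8 + 18 / eta) / N%:R; pose k2 : R := 36 / (N%:R * r).
pose k0 : R := 9 / r + 18 * eta.
have bk : bounded_mfun (fun y => k0 + (k1 * u y + k2 * `|D y|)).
  apply: bounded_mfunD; first exact: bounded_mfun_cst.
  by apply: bounded_mfunD; apply: bounded_mfunZ => //; exact: bounded_mfun_norm.
apply: (le_trans (le_norm_Rint _ bdiff)).
apply: (@le_trans _ _ (\int[Q]_y (k0 + (k1 * u y + k2 * `|D y|)))).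
  apply: (le_Rint_ae mS S0) => //; first exact: bounded_mfun_norm.
  move=> y /Snot[y0 yinj].
  have [U [t [rs [rs_inj WE uE DE]]]] := latent_rank_sflip y0 yinj.
  have h01 (x : R) : (0 : R) <= (\1_A x : R) <= 1.
    by rewrite indicE ler0n lern1 leq_b1.
  have := sign_avg_rsum_smooth U t h01 N8 eta0.
  rewrite -/(fair_prob A) DE uE.
  rewrite -(sign_avg_inj _ rs_inj).
  rewrite [X in `|X - _| <= _ -> _](_ : _ = sign_avg (fun s =>
    \1_(W @^-1` A) (Th s y) : R)); last first.
    apply: eq_sign_avg => s; rewrite -DE -WE !indicE; congr ((_ : bool)%:R).

  move=> h; apply: (le_trans h); rewrite -/(u y) -/(D y) -/r /k0 /k1 /k2 rr.
  rewrite le_eqVlt; apply/orP; left; apply/eqP.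
  by field; rewrite !gt_eqF.
rewrite RintD; [|exact: bounded_mfun_cst|by apply: bounded_mfunD;
  apply: bounded_mfunZ => //; exact: bounded_mfun_norm].
rewrite (RintD Q (bounded_mfunZ k1 bu) (bounded_mfunZ k2
  (bounded_mfun_norm bD))).
rewrite Rint_cst !RintZ//; last exact: bounded_mfun_norm.
have Iu : \int[Q]_y u y = N%:R * e.
  rewrite /u Rint_sum; last by move=> i; exact: (bounded_mfun_tnth i bc).
  rewrite (eq_bigr (fun=> e)); first by rewrite sumr_const card_ord mulr_natl.
  by move=> i _; rewrite (Rint_tnth QL i bc).
have e0 : 0 <= e.
  by rewrite -L_contam; apply: Rintegral_ge0 => z _.
(* Here the projection error carries [e] in place of 1, which keeps [|D|] within o(n^(3/2)) of its
   centre. *)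
have ID : \int[Q]_y `|D y| <= N%:R ^+ 2 * m + N%:R * r * (e + eta / 2 + e /
  (2 * eta)).
  have cs1 (z : Z) : `|contam_sg z| <= 1.
    rewrite /contam_sg normrM ger0_norm//; apply: mulr_ile1 => //;
      last exact: sgr_norm_le1.
    by rewrite lern1; case: (z.1).
  have := hajek_bound mv QL bcs cs1 eta0 (ltn0Sn n).
  rewrite m_contam -/r -/(D _) => hD.
  have bDm : bounded_mfun (fun y => `|D y - N%:R ^+ 2 * m|).
    by apply: bounded_mfun_norm; apply: bounded_mfunB => //;
      exact: bounded_mfun_cst.
  apply: (@le_trans _ _ (\int[Q]_y (N%:R ^+ 2 * m + `|D y - N%:R ^+ 2 * m|))).
    apply: le_Rint; first exact: bounded_mfun_norm.
    - by apply: bounded_mfunD => //; exact: bounded_mfun_cst.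
    move=> y; rewrite -[X in X + _]ger0_norm ?mulr_ge0 ?exprn_ge0//.
    by apply: le_trans (ler_normD _ _); rewrite addrC subrK.
  rewrite RintD//; last exact: bounded_mfun_cst.
  rewrite Rint_cst lerD2l; apply: (le_trans hD).
  rewrite ler_pM2l ?mulr_gt0 ?ltr0n//.
  have : \int[L]_z `|contam_sg z| / (2 * eta) <= e / (2 * eta).
    by rewrite ler_pM2r ?invr_gt0 ?mulr_gt0.
  by move: L_contam_sg; lra.
have k20 : 0 <= k2 by rewrite divr_ge0 ?mulr_ge0 ?ltW.
apply: (@le_trans _ _ (k0 + (k1 * (N%:R * e) + k2 *
  (N%:R ^+ 2 * m + N%:R * r * (e + eta / 2 + e / (2 * eta)))))).
  by rewrite Iu !lerD2l ler_wpM2l.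
rewrite /k0 /k1 /k2 rr le_eqVlt; apply/orP; left; apply/eqP.
by field; rewrite !gt_eqF.
Qed.

End latent_sample.

(** * Total variation bounds *)

Section total_variation.
Context (R : realType) d (T : measurableType d) (P Q : probability T R).

Let S := [set `|fine (P A) - fine (Q A)| | A in measurable].

Let fine_prob_bounds (P' : probability T R) A : measurable A ->
  0 <= fine (P' A) <= 1.
Proof.
move=> mA; rewrite -!lee_fin fineK ?fin_num_measure//.
by rewrite measure_ge0 probability_le1.
Qed.

Let S_ub : ubound S 1.
Proof.
move=> _ [A mA <-]; have := fine_prob_bounds P mA;
  have := fine_prob_bounds Q mA.
by rewrite ler_norml; lra.
Qed.

Let S_sup : has_sup S.
Proof.
by split; [exists `|fine (P setT) - fine (Q setT)|, setT|exists 1; exact: S_ub].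
Qed.

Lemma tv_dist_ge A : measurable A -> 2 * `|fine (P A) - fine
  (Q A)| <= tv_dist P Q.
Proof.
by move=> mA; rewrite ler_pM2l//; apply: sup_upper_bound => //; exists A.
Qed.

Lemma tv_dist_le b : (forall A, measurable A -> `|fine (P A) - fine
  (Q A)| <= b) ->
  tv_dist P Q <= 2 * b.
Proof.
move=> Pb; rewrite ler_pM2l//; apply: ge_sup; first by case: S_sup.
by move=> _ [A mA <-]; exact: Pb.
Qed.

Lemma tv_dist_le2 : tv_dist P Q <= 2.
Proof.
rewrite -[leRHS]mulr1; apply: tv_dist_le => A mA.
by apply: S_ub; exists A.
Qed.

Lemma tv_dist_ge0 : 0 <= tv_dist P Q.
Proof.
apply: le_trans (tv_dist_ge measurableT).
by rewrite mulr_ge0.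
Qed.

End total_variation.

(** * Total variation between the two hypotheses *)

Section signed_rank_bounds.
Context (R : realType) (p q : probability R R) (F G : cumulativeBounded
  (0 : R) (1 : R)).
Variables (f g : R -> R).
Hypothesis p0 : no_atom p.
Hypothesis q0 : no_atom q.
Hypothesis pF : forall x, p `]-oo, x]%classic = (F x)%:E.
Hypothesis qG : forall x, q `]-oo, x]%classic = (G x)%:E.
Hypothesis pf : forall phi : R -> R, bounded_mfun phi ->
  \int[p]_x phi x = \int[lebesgue_measure]_x (phi x * f x).
Hypothesis qg : forall phi : R -> R, bounded_mfun phi ->
  \int[q]_x phi x = \int[lebesgue_measure]_x (phi x * g x).
Hypothesis Fsym : forall x, F (- x) = 1 - F x.
Hypothesis Gneg : forall x, G x + G (- x) <= 1.

Section one_law.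
Context (e mu : R) d (T : measurableType d) (P : probability T R) (n : nat)
  (X : 'I_n.+1 -> {mfun T >-> R}).
Hypothesis e01 : 0 <= e <= 1.
Hypothesis mu0 : 0 < mu.
Hypothesis iidX : iid P X (contaminated F G e mu).
Local Notation N := n.+1.
Local Notation m := (signed_mean G f g e mu).

Lemma signed_rank_deviation (A : set R) (k : R) : measurable A ->
  (forall x, A x -> N%:R ^+ 2 * k / 2 <= `|x - N%:R ^+ 2 * m|) ->
  0 < k ->
  fine (distribution P (signed_rank_stat X) A) <= 4 / (Num.sqrt N%:R * k).
Proof.
move=> mA Adev k0; have [L LE] := latent_ex p q mu e01.
have [Q QL] := product_law_ex L N.
rewrite (signed_rank_stat_law iidX _ QL)//; last exact: (latent_cdf pF qG LE).
apply: (latent_rank_deviation QL _ _ mA Adev k0).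
- exact: (latent_noatom p0 q0 LE).
- exact: (Rint_sg p0 q0 pF qG pf qg Fsym LE).
Qed.

Lemma signed_rank_fair (A : set R) (eta : R) : measurable A -> (8 <= N)%N ->
  0 < eta ->
  0 <= m ->
  `|fine (distribution P (signed_rank_stat X) A) - fair_prob n A| <=
  44 * e + 9 / Num.sqrt N%:R + 36 * (Num.sqrt N%:R * m) + 36 * eta + 36 *
    (e / eta).
Proof.
move=> mA N8 eta0 m0; have [L LE] := latent_ex p q mu e01.
have [Q QL] := product_law_ex L N.
rewrite (signed_rank_stat_law iidX _ QL)//; last exact: (latent_cdf pF qG LE).
apply: (latent_rank_fair QL) => //.
- exact: (latent_noatom p0 q0 LE).
- exact: (latent_sflip p0 pF Fsym LE).
- exact: (Rint_contam LE).
- exact: (Rint_norm_contam_sg LE).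
- exact: (Rint_contam_sg p0 q0 pF qG pf qg Fsym LE).
Qed.

End one_law.

Section two_laws.
Context (e mu : R) d (T : measurableType d) (P0 P1 : probability T R) (n : nat)
  (X : 'I_n -> {mfun T >-> R}).
Hypothesis e01 : 0 <= e <= 1.
Hypothesis mu0 : 0 < mu.
Hypothesis iid0 : iid P0 X F.
Hypothesis iid1 : iid P1 X (contaminated F G e mu).
Local Notation m := (signed_mean G f g e mu).
Local Notation tv := (tv_dist (distribution P0 (signed_rank_stat X))
  (distribution P1 (signed_rank_stat X))).

Let m_0 : signed_mean G f g 0 mu = 0.
Proof. by rewrite /signed_mean; lra. Qed.

Let iid0' : iid P0 X (contaminated F G 0 mu).
Proof.
rewrite (_ : contaminated F G 0 mu = F)//; apply/funext => x.
by rewrite /contaminated subr0 mul1r mul0r addr0.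
Qed.

Let zero01 : (0 : R) <= 0 <= (1 : R). Proof. by rewrite lexx ler01. Qed.

Lemma signed_rank_tv_ge : (0 < n)%N -> 0 < m -> 2 - 16 /
  (Num.sqrt n%:R * m) <= tv.
Proof.
move: X iid0' iid1; case: n => // k Y i0 i1 _ m0.
(* The threshold lies halfway between the centres 0 and [N^2 * m], so each error probability is at
   most [4 / (sqrt N * m)]. *)
pose A : set R := `](k.+1%:R ^+ 2 * m / 2), +oo[%classic.
have mA : measurable A by exact: measurable_itv.
have c0 : 0 < k.+1%:R ^+ 2 * m by rewrite mulr_gt0 ?exprn_gt0 ?ltr0n.
have := tv_dist_ge (distribution P0 (signed_rank_stat Y))
  (distribution P1 (signed_rank_stat Y)) mA.
apply: le_trans.
have h0 : fine (distribution P0 (signed_rank_stat Y) A) <= 4 /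
  (Num.sqrt k.+1%:R * m).
  apply: (signed_rank_deviation zero01 i0 mA _ m0) => x.
  rewrite /A /= in_itv/= andbT m_0 mulr0 subr0 => /ltW h.
  by apply: (le_trans h); exact: ler_norm.
have h1 : fine (distribution P1 (signed_rank_stat Y) (~` A)) <= 4 /
  (Num.sqrt k.+1%:R * m).
  apply: (signed_rank_deviation e01 i1 _ _ m0); first exact: measurableC.
  move=> x; rewrite /A /= in_itv/= andbT => /negP; rewrite -leNgt => h.
  by rewrite distrC; apply: le_trans (ler_norm _); lra.
have h2 : fine (distribution P1 (signed_rank_stat Y) (~` A)) =
    1 - fine (distribution P1 (signed_rank_stat Y) A).
  by rewrite probability_setC// fineB ?fin_num_measure.
rewrite h2 in h1.
have -> : 16 / (Num.sqrt k.+1%:R * m) = 4 * (4 / (Num.sqrt k.+1%:R * m)) by lra.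
move: (4 / _) h0 h1 => b h0 h1.
have := ler_norm (fine (distribution P1 (signed_rank_stat Y) A) -
  fine (distribution P0 (signed_rank_stat Y) A)).
by rewrite distrC; lra.
Qed.

Lemma signed_rank_tv_le (eta : R) : (8 <= n)%N -> 0 < eta -> 0 <= m ->
  tv <= 88 * e + 36 / Num.sqrt n%:R + 72 * (Num.sqrt n%:R * m) + 144 * eta +
    72 * (e / eta).
Proof.
move: X iid0' iid1; case: n => // k Y i0 i1 n8 eta0 m0.
apply: le_trans (_ : 2 * (44 * e + 18 / Num.sqrt k.+1%:R + 36 *
  (Num.sqrt k.+1%:R * m) +
  72 * eta + 36 * (e / eta)) <= _); last by lra.
apply: tv_dist_le => A mA.
have h0 := signed_rank_fair zero01 i0 mA n8 eta0.
have h1 := signed_rank_fair e01 i1 mA n8 eta0 m0.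
rewrite m_0 lexx in h0; have {}h0 := h0 isT.
rewrite -[_ - _](subrKA (fair_prob k A)).
apply: (le_trans (ler_normD _ _)).
rewrite [X in _ + X <= _]distrC.
by move: h0 h1; rewrite mulr0 mulr0 mul0r mulr0; lra.
Qed.

End two_laws.

(** For [e <= 1 / 2] the factor [2 * (1 - e)] lies between 1 and 2. As [zeta] and [lambda] are
    nonnegative, the mean is at least the larger and at most three times the larger of [e * zeta]
    and [e^2 * lambda]. *)
Lemma signed_mean_bounds (e mu : R) : 0 < e -> e <= 2^-1 -> 0 < mu ->
  e * Num.max (zeta G f mu) (e * lambda G g mu) <= signed_mean G f g e mu <=
  3 * (e * Num.max (zeta G f mu) (e * lambda G g mu)).
Proof.
move=> e0 e2 mu0.
have z0 := zeta_ge0 p0 pF qG pf Fsym Gneg mu0.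
have l0 := lambda_ge0 q0 qG qg Gneg mu0.
rewrite /signed_mean; move: (zeta _ _ _) (lambda _ _ _) z0 l0 => z l z0 l0.
have el0 : 0 <= e * l by rewrite mulr_ge0// ltW.
have ez0 : 0 <= e * z by rewrite mulr_ge0// ltW.
have eel0 : 0 <= e * (e * l) by rewrite mulr_ge0// ltW.
have eez0 : 0 <= e * (e * z) by rewrite mulr_ge0// ltW.
have eez : e * (e * z) <= 2^-1 * (e * z) by rewrite ler_wpM2r.
case: (leP z (e * l)) => [h|/ltW h].
  by have := ler_wpM2l (ltW e0) h => ?; apply/andP; split; lra.
by have := ler_wpM2l (ltW e0) h => ?; apply/andP; split; lra.
Qed.

End signed_rank_bounds.

Theorem proposition6 (R : realType)
    (F G : cumulativeBounded (0 : R) (1 : R)) (f g : R -> R)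
    (eps mu : nat -> R)
    (d : nat -> measure_display) (T : forall n : nat, measurableType (d n))
    (P0 P1 : forall n : nat, probability (T n) R)
    (X : forall n : nat, 'I_n -> {mfun T n >-> R}) :
  continuous F ->
  (forall x : R, F (- x) = 1 - F x) ->
  continuous G ->
  G 0 = 2^-1 ->
  is_density F f ->
  is_density G g ->
  (forall x : R, G x + G (- x) <= 1) ->
  (forall n : nat, 0 < eps n <= 1) ->
  eps n @[n --> \oo] --> (0 : R) ->
  (forall n : nat, 0 < mu n) ->
  (forall n : nat, iid (P0 n) (X n) F) ->
  (forall n : nat, iid (P1 n) (X n) (contaminated F G (eps n) (mu n))) ->
  ((Num.sqrt n%:R * eps n *
      Num.max (zeta G f (mu n)) (eps n * lambda G g (mu n)))
      @[n --> \oo] --> +oo ->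
    asymptotically_powerful P0 P1 (fun n : nat => signed_rank_stat (X n)))
  /\
  ((Num.sqrt n%:R * eps n *
      Num.max (zeta G f (mu n)) (eps n * lambda G g (mu n)))
      @[n --> \oo] --> (0 : R) ->
    asymptotically_powerless P0 P1 (fun n : nat => signed_rank_stat (X n))).
Proof.
move=> _ Fsym _ _ Ff Gg Gneg eps01 eps0 mu0 iid0 iid1.
have [p [pF p0 pf]] := density_law Ff.
have [q [qG q0 qg]] := density_law Gg.
have e01 n : 0 <= eps n <= 1 by have /andP[/ltW -> ->] := eps01 n.
have e0 n : 0 < eps n by have /andP[] := eps01 n.
have eps_small (c : R) : 0 < c -> \forall n \near \oo, eps n <= c.
  move=> c0; have /cvgr0Pnorm_le /(_ _ c0) := eps0.
  by apply: filterS => n; rewrite gtr0_norm.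
pose m n := signed_mean G f g (eps n) (mu n).
pose M n := eps n * Num.max (zeta G f (mu n)) (eps n * lambda G g (mu n)).
have mM n : eps n <= 2^-1 -> M n <= m n <= 3 * M n.
  by move=> e2; exact: (signed_mean_bounds p0 q0 pF qG pf qg Fsym Gneg
    (e0 n) e2 (mu0 n)).
split => hM.
  rewrite /asymptotically_powerful; apply/cvgrPdist_le => c c0.
  (* Beyond this threshold the loss [16 / (sqrt n * m)] is at most [c]. *)
  have /cvgryPge /(_ (16 / c)) hx := hM.
  near=> n.
  have n0 : (0 < n)%N by near: n; exact: nbhs_infty_gt.
  have r0 : 0 < Num.sqrt n%:R :> R by rewrite sqrtr_gt0 ltr0n.
  have e2 : eps n <= 2^-1 by near: n; apply: eps_small; rewrite invr_gt0.
  have xc : 16 / c <= Num.sqrt n%:R * M n by rewrite mulrA; near: n; exact: hx.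
  have /andP[Mm _] := mM n e2.
  have rm : 16 / c <= Num.sqrt n%:R * m n.
    by apply: (le_trans xc); rewrite ler_pM2l.
  have c16 : 0 < 16 / c by rewrite divr_gt0.
  have rm0 : 0 < Num.sqrt n%:R * m n by exact: lt_le_trans rm.
  have m0 : 0 < m n by rewrite -(pmulr_rgt0 _ r0).
  have := signed_rank_tv_ge p0 q0 pF qG pf qg Fsym (e01 n) (iid0 n)
    (iid1 n) n0 m0.
  have := tv_dist_le2 (distribution (P0 n) (signed_rank_stat (X n)))
    (distribution (P1 n) (signed_rank_stat (X n))).
  move: (tv_dist _ _) => tv tv2 tvge.
  have : 16 / (Num.sqrt n%:R * m n) <= c.
    by rewrite ler_pdivrMr// mulrC -ler_pdivrMr.
  by rewrite ger0_norm; rewrite -/(m n) in tvge; lra.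
rewrite /asymptotically_powerless; apply/cvgr0Pnorm_le => c c0.
(* The five error terms add up to at most (88 + 36 + 216 + 144 + 72) eta = 556 eta, below [c]. *)
pose eta := c / 10 / 10 / 10.
have eta0 : 0 < eta by rewrite !divr_gt0.
have /cvgr0Pnorm_le /(_ _ eta0) hx := hM.
near=> n.
have n8 : (8 <= n)%N by near: n; exact: nbhs_infty_ge.
have r0 : 0 < Num.sqrt n%:R :> R by rewrite sqrtr_gt0 ltr0n (leq_trans _ n8).
have e2 : eps n <= 2^-1 by near: n; apply: eps_small; rewrite invr_gt0.
have e_eta : eps n <= eta by near: n; exact: eps_small.
(* Smallness of [eps] against the square of [eta] controls the term [eps / eta]. *)
have e_eta2 : eps n <= eta * eta by near: n; apply: eps_small; rewrite mulr_gt0.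
have xc : Num.sqrt n%:R * M n <= eta.
  by apply: le_trans (ler_norm _) _; rewrite mulrA; near: n; exact: hx.
have rn : (Num.sqrt n%:R)^-1 <= eta.
  have h : eta ^- 2 <= n%:R by near: n; exact: nbhs_infty_ger.
  rewrite -[X in _ <= X]invrK lef_pV2 ?posrE ?invr_gt0//.
  rewrite -(@ler_pXn2r _ 2) ?nnegrE ?invr_ge0 ?sqrtr_ge0 ?(ltW eta0)//.
  by rewrite sqr_sqrtr// exprVn.
have /andP[Mm m3] := mM n e2.
have M0 : 0 <= M n.
  rewrite mulr_ge0 ?(ltW (e0 n))// le_max (zeta_ge0 p0 pF qG pf Fsym Gneg
    (mu0 n)).
  by [].
have m0 : 0 <= m n by exact: le_trans Mm.
have rm : Num.sqrt n%:R * m n <= 3 * eta.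
  apply: (@le_trans _ _ (Num.sqrt n%:R * (3 * M n))); first by rewrite ler_pM2l.
  by rewrite mulrCA ler_pM2l.
have ee : eps n / eta <= eta by rewrite ler_pdivrMr.
rewrite ger0_norm ?tv_dist_ge0//.
apply: (le_trans (signed_rank_tv_le p0 q0 pF qG pf qg Fsym (e01 n) (iid0 n)
  (iid1 n) n8 eta0 m0)).
have cE : 10 * (10 * (10 * eta)) = c by rewrite /eta; lra.
rewrite -/(m n) -[leRHS]cE.
have final (a b b' x y : R) : 0 < y -> a <= 3 * y -> b <= y -> b' <= y ->
  x <= y ->
    88 * x + 36 * b + 72 * a + 144 * y + 72 * b' <= 10 * (10 * (10 * y)).
  by move=> *; lra.
exact: final.
Unshelve. all: by end_near.
Qed.
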